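(* Let $\pi:M(c)\to N$ be an anti-invariant submersion from a quaternionic space form $(M(c),g_M)$ onto a Riemannian manifold $(N,g_N)$, and let $r=\dim\ker\pi_*$. Then $$\hat\tau\ \ge\ \frac c4 r(r-1)-r^2\|H\|^2 .$$ Equality holds (at every point) if and only if each fiber of $\pi$ is totally geodesic.
   Context: An almost quaternionic Hermitian manifold $(M,E,g_M)$ is a $4m$-dimensional Riemannian manifold with a rank 3 subbundle $E\subset \mathrm{End}(TM)$ having, near each point, a local basis $\{J_1,J_2,J_3\}$ of sections with $J_\alpha^2=-\mathrm{id}$, $J_\alpha J_{\alpha+1}=-J_{\alpha+1}J_\alpha=J_{\alpha+2}$ (indices mod 3) and $g_M(J_\alpha X,J_\alpha Y)=g_M(X,Y)$. It is quaternionic Kähler if there are local 1-forms $\omega_1,\omega_2,\omega_3$ with $\nabla_XJ_\alpha=\omega_{\alpha+2}(X)J_{\alpha+1}-\omega_{\alpha+1}(X)J_{\alpha+2}$, $\nabla$ the Levi-Civita connection. A quaternionic space form $M(c)$ ($c\in\mathbb R$) is a quaternionic Kähler manifold whose curvature tensor is $$R(X,Y)Z=\tfrac c4\Big\{g_M(Y,Z)X-g_M(X,Z)Y+\sum_{\alpha=1}^3\big(g_M(J_\alpha Y,Z)J_\alpha X-g_M(J_\alpha X,Z)J_\alpha Y+2g_M(J_\alpha Y,X)J_\alpha Z\big)\Big\}.$$ A Riemannian submersion $\pi:(M,g_M)\to(N,g_N)$ ($\dim M>\dim N$) is a smooth surjective map of maximal rank whose differential restricted to $(\ker\pi_* )^\perp$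 is a linear isometry. Write $\mathcal V=\ker\pi_*$ (vertical), $\mathcal H=(\ker\pi_* )^\perp$ (horizontal), and use the same letters for the orthogonal projections. The submersion $\pi$ is anti-invariant if $J_\alpha(\ker\pi_* )\subset(\ker\pi_* )^\perp$ for $\alpha=1,2,3$. O'Neill tensor: $\mathcal T_EF=\mathcal H\nabla_{\mathcal VE}\mathcal VF+\mathcal V\nabla_{\mathcal VE}\mathcal HF$. The mean curvature vector field of the fibers is $H=\frac1r\sum_{j=1}^r\mathcal T_{U_j}U_j$ for an orthonormal frame $\{U_1,\dots,U_r\}$ of $\mathcal V$. The fibers are totally geodesic if $\mathcal T$ vanishes identically. Curvature convention: $R(X,Y,Z,W)=g_M(R(X,Y)Z,W)$, and the curvature tensor $\hat R$ of the vertical distribution (fibers) is related to $R$ by $$R(U,V,F,W)=\hat R(U,V,F,W)+g_M(\mathcal T_UW,\mathcal T_VF)-g_M(\mathcal T_VW,\mathcal T_UF)$$ for vertical $U,V,F,W$; the sign of the curvature tensors is the one for which this holds, i.e. $R(X,Y)Z=\nabla_{[X,Y]}Z-\nabla_X\nabla_YZ+\nabla_Y\nabla_XZ$. Finally $\widehat{Ric}(U)=\sum_{i=1}^r\hat R(U,U_i,U_i,U)$ and $\hat\tau=\sum_{j=1}^r\widehat{Ric}(U_j)$. *)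

(* Defs.v *)
From HB Require Import structures.
From mathcomp Require Import all_boot all_order all_algebra.
From mathcomp Require Import all_classical all_reals all_analysis.

Set Implicit Arguments.
Unset Strict Implicit.
Unset Printing Implicit Defensive.

Import Order.TTheory GRing.Theory Num.Theory.
Import numFieldNormedType.Exports.

Local Open Scope classical_set_scope.
Local Open Scope ring_scope.

Section SmoothMaps.
Context {R : realType} {V W : normedModType R}.

(* Meant for open O; V is finite dimensional in every use below. *)
Fixpoint Ck_on (k : nat) (O : set V) (f : V -> W) : Prop :=
  match k with
  | 0%N => forall x, O x -> {for x, continuous f}
  | k'.+1 => (forall x, O x -> differentiable f x) /\
             (forall v, Ck_on k' O (fun x => 'D_v f x))
  end.

Definition smooth_on (O : set V) (f : V -> W) : Prop := forall k, Ck_on k O f.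

End SmoothMaps.

(* [coord] and [param] are total functions; only their values on [dom] and on
   [coord @` dom] are meaningful, where they are mutually inverse. *)
Record chart (R : realType) (n : nat) (M : topologicalType) := Chart {
  dom : set M;
  coord : M -> 'rV[R]_n;
  param : 'rV[R]_n -> M }.

Definition is_chart (R : realType) (n : nat) (M : topologicalType)
    (phi : chart R n M) : Prop :=
  [/\ open (dom phi),
      open (coord phi @` dom phi),
      (forall p, dom phi p -> param phi (coord phi p) = p),
      (forall p, dom phi p -> {for p, continuous (coord phi)}) &
      (forall x, (coord phi @` dom phi) x -> {for x, continuous (param phi)})].

(* The tangent space at p is represented by 'rV[R]_n, a tangent vector being
   identified with its components in the reference chart [chart_at p].
   Accordingly vector fields are functions M -> 'rV[R]_n, and endomorphisms of
   the tangent space at p are elements of 'End('rV[R]_n). *)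
Record manifold (R : realType) (n : nat) := Manifold {
  carrier :> topologicalType;
  atlas : set (chart R n carrier);
  chart_at : carrier -> chart R n carrier;
  manifold_hausdorff : hausdorff_space carrier;
  manifold_second_countable : @second_countable carrier;
  atlas_chart : forall phi, atlas phi -> is_chart phi;
  atlas_chart_at : forall p, atlas (chart_at p);
  mem_chart_at : forall p, dom (chart_at p) p;
  atlas_compatible : forall phi psi, atlas phi -> atlas psi ->
    smooth_on (coord phi @` (dom phi `&` dom psi)) (coord psi \o param phi) }.

Section Calculus.
Context {R : realType} {n : nat} (M : manifold R n).
Implicit Types (p q : M) (X Y : M -> 'rV[R]_n).

Definition smooth_near {W : normedModType R} p (f : M -> W) : Prop :=
  exists O : set M, [/\ open O, O p &
    forall phi, atlas phi ->
      smooth_on (coord phi @` (O `&` dom phi)) (f \o param phi)].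

(* The derivative v(f) of f along the tangent vector v at p. *)
Definition tder {W : normedModType R} (f : M -> W) p (v : 'rV[R]_n) : W :=
  'D_v (f \o param (chart_at p)) (coord (chart_at p) p).

(* The component functions near p of X in the one chart [chart_at p]. *)
Definition components p X : M -> 'rV[R]_n :=
  fun q => tder (coord (chart_at p)) q (X q).

Definition smooth_field p X : Prop := smooth_near p (components p X).

(* [X, Y]^k = X(Y^k) - Y(X^k) in [chart_at p]. *)
Definition bracket X Y : M -> 'rV[R]_n :=
  fun p => tder (components p Y) p (X p) - tder (components p X) p (Y p).

Definition smooth_endo p (J : M -> 'End('rV[R]_n)) : Prop :=
  forall X, smooth_field p X -> smooth_field p (fun q => J q (X q)).

Definition smooth_form p (w : M -> 'Hom('rV[R]_n, R^o)) : Prop :=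
  forall X, smooth_field p X -> smooth_near p (fun q => w q (X q)).

End Calculus.

Section Riemannian.
Context {R : realType} {n : nat} (M : manifold R n).
Variable g : M -> 'rV[R]_n -> 'rV[R]_n -> R.

Definition riemannian_metric : Prop :=
  [/\ (forall (p : M) (a : R) u v w, g p (a *: u + v) w = a * g p u w + g p v w),
      (forall (p : M) u v, g p u v = g p v u),
      (forall (p : M) u, u != 0 -> 0 < g p u u) &
      (forall (p : M) X Y, smooth_field p X -> smooth_field p Y ->
         smooth_near p (fun q => g q (X q) (Y q)))].

(* A connection is an operator on all functions M -> 'rV[R]_n, of which only
   the values at p on fields that are smooth near p are meaningful.  Locality
   need not be required: it follows from the Leibniz rule applied to indicator
   functions of neighborhoods of p, which are smooth near p. *)
Definition levi_civita
    (nabla : (M -> 'rV[R]_n) -> (M -> 'rV[R]_n) -> M -> 'rV[R]_n) : Prop :=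
  forall (p : M) (X X' Y Y' : M -> 'rV[R]_n) (f : M -> R),
    smooth_field p X -> smooth_field p X' ->
    smooth_field p Y -> smooth_field p Y' -> smooth_near p f ->
    [/\ smooth_field p (nabla X Y),
        nabla (fun q => f q *: X q + X' q) Y p = f p *: nabla X Y p + nabla X' Y p,
        nabla X (fun q => f q *: Y q + Y' q) p =
          tder f p (X p) *: Y p + f p *: nabla X Y p + nabla X Y' p,
        nabla X Y p - nabla Y X p = bracket X Y p &
        tder (fun q => g q (Y q) (Y' q)) p (X p) =
          g p (nabla X Y p) (Y' p) + g p (Y p) (nabla X Y' p)].

(* Note the sign: R(X, Y)Z = D_[X, Y] Z - D_X D_Y Z + D_Y D_X Z. *)
Definition curvature
    (D : (M -> 'rV[R]_n) -> (M -> 'rV[R]_n) -> M -> 'rV[R]_n)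
    (X Y Z : M -> 'rV[R]_n) : M -> 'rV[R]_n :=
  fun p => D (bracket X Y) Z p - D X (D Y Z) p + D Y (D X Z) p.

Definition orthov (p : M) (A : {vspace 'rV[R]_n}) : {vspace 'rV[R]_n} :=
  (\bigcap_(u <- vbasis A) lker (linfun (g p u : 'rV[R]_n -> R^o)))%VS.

End Riemannian.

Section Quaternionic.
Context {R : realType} {m : nat} (M : manifold R (4 * m)).
Variable E : M -> {vspace 'End('rV[R]_(4 * m))}.
Variable g : M -> 'rV[R]_(4 * m) -> 'rV[R]_(4 * m) -> R.
Variable nabla :
  (M -> 'rV[R]_(4 * m)) -> (M -> 'rV[R]_(4 * m)) -> M -> 'rV[R]_(4 * m).

(* A local basis J_1, J_2, J_3 of E near p; indices are taken in 'I_3, whose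
   ring structure is that of the integers mod 3. *)
Definition quaternionic_basis (p : M) (J : 'I_3 -> M -> 'End('rV[R]_(4 * m)))
    : Prop :=
  (forall a, smooth_endo p (J a)) /\
  \forall q \near p,
    [/\ basis_of (E q) [:: J 0 q; J 1 q; J 2%:R q],
        (forall a v, J a q (J a q v) = - v),
        (forall a v, J a q (J (a + 1) q v) = J (a + 2%:R) q v),
        (forall a v, J (a + 1) q (J a q v) = - J (a + 2%:R) q v) &
        (forall a u v, g q (J a q u) (J a q v) = g q u v)].

Definition almost_quaternionic_hermitian : Prop :=
  riemannian_metric g /\ forall p, exists J, quaternionic_basis p J.

Definition quaternionic_kahler : Prop :=
  almost_quaternionic_hermitian /\
  forall p, exists2 J, quaternionic_basis p J &
    exists2 w : 'I_3 -> M -> 'Hom('rV[R]_(4 * m), R^o),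
      (forall a, smooth_form p (w a)) &
      \forall q \near p, forall X Y, smooth_field q X -> smooth_field q Y ->
        forall a,
          nabla X (fun q' => J a q' (Y q')) q - J a q (nabla X Y q) =
          w (a + 2%:R) q (X q) *: J (a + 1) q (Y q)
          - w (a + 1) q (X q) *: J (a + 2%:R) q (Y q).

Definition quaternionic_space_form (c : R) : Prop :=
  quaternionic_kahler /\
  forall p J, quaternionic_basis p J ->
  forall X Y Z, smooth_field p X -> smooth_field p Y -> smooth_field p Z ->
    curvature nabla X Y Z p =
    (c / 4%:R) *:
      (g p (Y p) (Z p) *: X p - g p (X p) (Z p) *: Y p +
       \sum_(a < 3) (g p (J a p (Y p)) (Z p) *: J a p (X p)
                     - g p (J a p (X p)) (Z p) *: J a p (Y p)
                     + (2%:R * g p (J a p (Y p)) (X p)) *: J a p (Z p))).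

End Quaternionic.

Section Submersion.
Context {R : realType} {d n : nat} (M : manifold R d) (N : manifold R n).
Variables (gM : M -> 'rV[R]_d -> 'rV[R]_d -> R)
          (gN : N -> 'rV[R]_n -> 'rV[R]_n -> R).
Variable pi : M -> N.

Definition smooth_map : Prop :=
  continuous pi /\
  forall p, smooth_near p (coord (chart_at (pi p)) \o pi).

Definition tangent_map (p : M) : 'Hom('rV[R]_d, 'rV[R]_n) :=
  linfun (tder (coord (chart_at (pi p)) \o pi) p).

Definition verts (p : M) : {vspace 'rV[R]_d} := lker (tangent_map p).

Definition horis (p : M) : {vspace 'rV[R]_d} := orthov gM p (verts p).

Definition riemannian_submersion : Prop :=
  [/\ (n < d)%N,
      smooth_map,
      (forall y, exists p, pi p = y),
      (forall p, limg (tangent_map p) = fullv) &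
      (forall p u v, u \in horis p -> v \in horis p ->
         gN (pi p) (tangent_map p u) (tangent_map p v) = gM p u v)].

Definition vproj (X : M -> 'rV[R]_d) : M -> 'rV[R]_d :=
  fun p => daddv_pi (verts p) (horis p) (X p).

Definition hproj (X : M -> 'rV[R]_d) : M -> 'rV[R]_d :=
  fun p => daddv_pi (horis p) (verts p) (X p).

Variable nabla : (M -> 'rV[R]_d) -> (M -> 'rV[R]_d) -> M -> 'rV[R]_d.

Definition oneillT (X Y : M -> 'rV[R]_d) : M -> 'rV[R]_d :=
  fun p => hproj (nabla (vproj X) (vproj Y)) p
           + vproj (nabla (vproj X) (hproj Y)) p.

Definition totally_geodesic_fibers : Prop :=
  forall p X Y, smooth_field p X -> smooth_field p Y -> oneillT X Y p = 0.

(* The connection induced on the fibers, i.e. on vertical vector fields. *)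
Definition nablahat (X Y : M -> 'rV[R]_d) : M -> 'rV[R]_d :=
  vproj (nabla X Y).

Definition Rhat (U V F W : M -> 'rV[R]_d) : M -> R :=
  fun p => gM p (curvature nablahat U V F p) (W p).

Variable r : nat.

(* It spans the vertical spaces near p when these have dimension r. *)
Definition orthonormal_vertical_frame (p : M) (U : 'I_r -> M -> 'rV[R]_d)
    : Prop :=
  (forall i, smooth_field p (U i)) /\
  \forall q \near p,
    (forall i, U i q \in verts q) /\
    (forall i j, gM q (U i q) (U j q) = (i == j)%:R).

Definition mean_curvature (U : 'I_r -> M -> 'rV[R]_d) : M -> 'rV[R]_d :=
  fun p => (r%:R)^-1 *: \sum_j oneillT (U j) (U j) p.

Definition Richat (U : 'I_r -> M -> 'rV[R]_d) (V : M -> 'rV[R]_d) : M -> R :=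
  fun p => \sum_i Rhat V (U i) (U i) V p.

Definition tauhat (U : 'I_r -> M -> 'rV[R]_d) : M -> R :=
  fun p => \sum_j Richat U (U j) p.

End Submersion.

Definition anti_invariant (R : realType) (m n : nat)
    (M : manifold R (4 * m)) (N : manifold R n)
    (E : M -> {vspace 'End('rV[R]_(4 * m))})
    (gM : M -> 'rV[R]_(4 * m) -> 'rV[R]_(4 * m) -> R) (pi : M -> N) : Prop :=
  forall p J, quaternionic_basis E gM p J ->
  forall a v, v \in verts pi p -> J a p v \in horis gM pi p.

(* Main.v *)
Require Import Defs.
From HB Require Import structures.
From mathcomp Require Import all_boot all_order all_algebra.
From mathcomp Require Import all_classical all_reals all_analysis.
From mathcomp Require Import ring.

Set Implicit Arguments.
Unset Strict Implicit.
Unset Printing Implicit Defensive.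

Import Order.TTheory GRing.Theory Num.Theory.
Import numFieldNormedType.Exports.

Local Open Scope classical_set_scope.
Local Open Scope ring_scope.

(** Let U_1, ..., U_r be a smooth orthonormal frame of the vertical distribution
    near a point, write h for the horizontal projection and
    h_ij = h(nabla_{U_i} U_j) for the second fundamental form of the fibres.
    Replacing nabla by its vertical part in the curvature tensor gives the Gauss
    equation ([gauss_equation]); summed over the frame it reads
      tauhat = sum_ij R(U_j, U_i, U_i, U_j) - |sum_i h_ii|^2 + sum_ij g(h_ij, h_ji).
    The middle term is r^2 |H|^2, and h_ij = h_ji because the bracket of vertical
    fields is vertical ([hproj_nabla_sym]), so the last sum is sum_ij |h_ij|^2.
    Anti-invariance makes every g(J_alpha U_i, U_j) vanish, which reduces the
    curvature of the space form on vertical vectors to that of a real space form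
    of curvature c/4 ([vertical_curvature]).  Altogether ([tauhat_frame])
      tauhat = c/4 r (r - 1) - r^2 |H|^2 + sum_ij |h_ij|^2,
    which gives the inequality.  Equality at every point means that all h_ij
    vanish, for some frame near each point; as the O'Neill tensor is tensorial
    and its value on a horizontal argument is the adjoint of its value on
    vertical ones, this is the vanishing of the O'Neill tensor ([oneillT_eq0]).

    The analysis behind this is of three kinds.  The vertical distribution is
    the kernel of the Jacobian of pi in charts: it is involutive by the symmetry
    of second derivatives ([derive_swap], [kernel_involutive]), and a vector of
    the kernel at one point extends to a smooth field of kernel vectors by
    Cramer's rule ([kernel_field]).  Orthonormal vertical frames exist by
    Gram-Schmidt ([vertical_frame_exists]), and they make the vertical and
    horizontal projections of a smooth field smooth.  Since a tangent vector is
    recorded in a chart chosen at its base point, without any regularity of that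
    choice, all of this has to be carried through changes of charts
    ([smooth_near_chart], [tder_comp]). *)

(** * The calculus of C^k functions *)

Section CkCalculus.
Context {R : realType}.

Lemma near_eq_differentiable (V W : normedModType R) (f g : V -> W) (a : V) :
  (\forall x \near a, f x = g x) -> differentiable f a -> differentiable g a.
Proof.
move=> fg df; have fa : f a = g a by exact: nbhs_singleton fg.
have gE : g \o shift a = cst (g a) + 'd f a +o_ 0 id.
  have /eqaddoP fE := diff_locally df.
  apply/eqaddoP => e e0; move: (fE e e0) => {}fE.
  have fg0 : \forall h \near (0 : V), f (h + a) = g (h + a).
    by move: fg; rewrite (near_shift 0 a) /= subr0.
  by near do rewrite !fctE /= -fa -(near fg0) //; apply: filterS fE.
apply/diff_locallyP; rewrite (diff_unique _ gE); last exact: diff_continuous.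
by split; [exact: diff_continuous|].
Unshelve. all: by end_near. Qed.

Lemma nbhs_open (T : topologicalType) (O : set T) x :
  open O -> O x -> \forall y \near x, O y.
Proof. by move=> Oo Ox; apply: open_nbhs_nbhs. Qed.

Lemma Ck_on_eq (V W : normedModType R) k (O : set V) (f g : V -> W) :
  open O -> (forall x, O x -> f x = g x) -> Ck_on k O f -> Ck_on k O g.
Proof.
move=> Oo; elim: k f g => [|k IH] f g fg /=.
  move=> fc x Ox; have fgx : \forall y \near x, f y = g y.
    by apply: filterS (nbhs_open Oo Ox) => y; exact: fg.
  by apply: cvg_trans (near_eq_cvg _) _; [exact: fgx|rewrite -fg//; exact: fc].
move=> [df Df].
have fgx x : O x -> \forall y \near x, f y = g y.
  by move=> Ox; apply: filterS (nbhs_open Oo Ox) => y; exact: fg.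
split=> [x Ox|v]; first exact: near_eq_differentiable (fgx x Ox) (df x Ox).
by apply: IH (Df v) => x Ox; exact: near_eq_derive (fgx x Ox).
Qed.

Lemma Ck_on_sub (V W : normedModType R) k (O O' : set V) (f : V -> W) :
  O' `<=` O -> Ck_on k O f -> Ck_on k O' f.
Proof.
move=> OO'; elim: k f => [|k IH] f /= => [fc x /OO'|[df Df]]; first exact: fc.
by split=> [x /OO'|v]; [exact: df|exact: IH].
Qed.

Lemma Ck_onW (V W : normedModType R) k (O : set V) (f : V -> W) :
  Ck_on k.+1 O f -> Ck_on k O f.
Proof.
elim: k f => [|k IH] f [df Df].
  by move=> x Ox; exact/differentiable_continuous/df.
by split=> // v; exact: IH.
Qed.

Lemma Ck_on_cst (V W : normedModType R) k (O : set V) (a : W) :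
  Ck_on k O (fun _ : V => a).
Proof.
elim: k a => [|k IH] a /=; first by move=> x _; exact: cst_continuous.
split=> [x _|v]; first exact: differentiable_cst.
rewrite (_ : (fun x => 'D_v _ x) = fun=> 0); first exact: IH.
by apply/funext => x; rewrite derive_cst.
Qed.

Lemma Ck_onD (V W : normedModType R) k (O : set V) (f g : V -> W) :
  open O -> Ck_on k O f -> Ck_on k O g -> Ck_on k O (fun x => f x + g x).
Proof.
move=> Oo; elim: k f g => [|k IH] f g /=.
  by move=> fc gc x Ox; apply: continuousD; [exact: fc|exact: gc].
move=> [df Df] [dg Dg]; split=> [x Ox|v].
  by apply: differentiableD; [exact: df|exact: dg].
apply: Ck_on_eq Oo _ (IH _ _ (Df v) (Dg v)) => x Ox.
by rewrite -deriveD//; apply: diff_derivable; [exact: df|exact: dg].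
Qed.

Lemma scale_bilinear (W : lmodType R) :
  bilinear_for (GRing.Scale.Law.clone _ _ *:%R _)
               (GRing.Scale.Law.clone _ _ *:%R _) ( *:%R : R -> W -> W).
Proof.
split=> [u' a x y|u' a x y] /=; last by rewrite scalerDr !scalerA mulrC.
by rewrite scalerDl scalerA.
Qed.

Lemma scale_fun_derive (V W : normedModType R) (f : V -> R) (g : V -> W) x :
  differentiable f x -> differentiable g x ->
  differentiable (fun y => f y *: g y) x /\
  forall v, 'D_v (fun y => f y *: g y) x = 'D_v f x *: g x + f x *: 'D_v g x.
Proof.
move=> df dg.
pose B : {bilinear R -> W -> W} := HB.pack ( *:%R : R -> W -> W)
  (bilinear_isBilinear.Build R R W W _ _ _ (scale_bilinear W)).
have cB : continuous (fun p : R * W => B p.1 p.2) by exact: scale_continuous.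
have dp := differentiable_pair df dg.
have dB := differentiable_bilin (f x, g x) cB.
have E : (fun y => f y *: g y) = (fun p => B p.1 p.2) \o (fun y => (f y, g y)).
  by [].
split=> [|v]; first by rewrite E; exact: differentiable_comp.
rewrite deriveE; last by rewrite E; exact: differentiable_comp.
rewrite E diff_comp//=.
have := @diff_bilin _ _ _ _ B (f x, g x) cB => /= ->.
by rewrite diff_pair//= !deriveE// addrC.
Qed.

Lemma Ck_onZ (V W : normedModType R) k (O : set V) (f : V -> R) (g : V -> W) :
  open O -> Ck_on k O f -> Ck_on k O g -> Ck_on k O (fun x => f x *: g x).
Proof.
move=> Oo; elim: k f g => [|k IH] f g /=.
  by move=> fc gc x Ox; apply: continuousZ; [exact: fc|exact: gc].
move=> Cf Cg; have [[df Df] [dg Dg]] := (Cf, Cg).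
have dfg x Ox := scale_fun_derive (df x Ox) (dg x Ox).
split=> [x Ox|v]; first exact: (dfg x Ox).1.
have fDg := IH _ _ (Ck_onW Cf) (Dg v).
have gDf := IH _ _ (Df v) (Ck_onW Cg).
by apply: Ck_on_eq Oo _ (Ck_onD Oo gDf fDg) => x Ox; rewrite (dfg x Ox).2.
Qed.

Lemma Ck_onM (V : normedModType R) k (O : set V) (f g : V -> R) :
  open O -> Ck_on k O f -> Ck_on k O g -> Ck_on k O (fun x => f x * g x).
Proof. exact: Ck_onZ. Qed.

Lemma Ck_on_sum (V W : normedModType R) k (O : set V) (I : Type)
    (s : seq I) (P : pred I) (f : I -> V -> W) :
  open O -> (forall i, Ck_on k O (f i)) ->
  Ck_on k O (fun x => \sum_(i <- s | P i) f i x).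
Proof.
move=> Oo fC; elim: s => [|i s IH].
  by under eq_fun do rewrite big_nil; exact: Ck_on_cst.
under eq_fun do rewrite big_cons.
by case: (P i) => //; exact: Ck_onD.
Qed.

Lemma Ck_on_prod (V : normedModType R) k (O : set V) (I : Type)
    (s : seq I) (P : pred I) (f : I -> V -> R) :
  open O -> (forall i, Ck_on k O (f i)) ->
  Ck_on k O (fun x => \prod_(i <- s | P i) f i x).
Proof.
move=> Oo fC; elim: s => [|i s IH].
  by under eq_fun do rewrite big_nil; exact: Ck_on_cst.
under eq_fun do rewrite big_cons.
by case: (P i) => //; exact: Ck_onM.
Qed.

Lemma differentiable_rV (V : normedModType R) n (f : V -> 'rV[R]_n) x :
  (forall j, differentiable (fun y => f y 0 j : R) x) -> differentiable f x.
Proof.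
move=> df; rewrite (_ : f = \sum_j (fun y => f y 0 j *: delta_mx 0 j)).
  by apply: differentiable_sum => j; exact: differentiableZl.
by apply/funext => y; rewrite fct_sumE -row_sum_delta.
Qed.

Lemma derive_rV (V : normedModType R) n (f : V -> 'rV[R]_n) x v j :
  derivable f x v -> ('D_v f x) 0 j = 'D_v (fun y => f y 0 j : R) x.
Proof. by move=> df; rewrite derive_mx// mxE. Qed.

Lemma differentiable_entry (V : normedModType R) n (f : V -> 'rV[R]_n) x j :
  differentiable f x -> differentiable (fun y => f y 0 j : R) x.
Proof.
move=> df.
exact: (differentiable_comp df (differentiable_coord (f x) 0 j)).
Qed.

Lemma Ck_on_rV (V : normedModType R) n k (O : set V) (f : V -> 'rV[R]_n) :
  open O ->
  Ck_on k O f <-> forall j, Ck_on k O (fun y => f y 0 j : R).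
Proof.
move=> Oo; elim: k f => [|k IH] f /=; split.
- move=> fc j x Ox; apply: (@continuous_comp _ _ _ f (fun y => y 0 j)).
    exact: fc.
  exact: coord_continuous.
- move=> fc x Ox.
  rewrite (_ : f = \sum_j (fun y => f y 0 j *: delta_mx 0 j)); last first.
    by apply/funext => y; rewrite fct_sumE -row_sum_delta.
  suff : forall s : seq 'I_n, {for x, continuous
      (\sum_(j <- s) (fun y => f y 0 j *: delta_mx 0 j : 'rV[R]_n))} by [].
  elim=> [|j s IHs]; first by rewrite big_nil; exact: cst_continuous.
  rewrite big_cons; apply: continuousD IHs.
  by apply: continuousZ; [exact: fc|exact: cst_continuous].
- move=> [df Df] j; split=> [x Ox|v]; first exact/differentiable_entry/df.
  apply: Ck_on_eq Oo _ ((IH _).1 (Df v) j) => x Ox.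
  by rewrite derive_rV//; exact/diff_derivable/df.
- move=> fC; have df x : O x -> differentiable f x.
    by move=> Ox; apply: differentiable_rV => j; exact: (fC j).1.
  split=> // v; apply/IH => j.
  apply: Ck_on_eq Oo _ ((fC j).2 v) => x Ox.
  by rewrite derive_rV//; exact/diff_derivable/df.
Qed.

Lemma derive_comp (U V W : normedModType R) (h : U -> V) (f : V -> W) x v :
  differentiable h x -> differentiable f (h x) ->
  'D_v (f \o h) x = 'D_('D_v h x) f (h x).
Proof.
move=> dh df; rewrite !deriveE//; last exact: differentiable_comp.
by rewrite diff_comp.
Qed.

Lemma derive_linear (V W : normedModType R) (f : V -> W) x :
  differentiable f x -> linear (fun v => 'D_v f x).
Proof. by move=> df a u v; rewrite !deriveE// linearP. Qed.

Lemma derive_basis d (W : normedModType R) (f : 'rV[R]_d -> W) x v :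
  differentiable f x ->
  'D_v f x = \sum_j v 0 j *: 'D_(delta_mx 0 j) f x.
Proof.
move=> df; rewrite deriveE// [in LHS](row_sum_delta v) linear_sum.
by apply: eq_bigr => j _; rewrite linearZ/= deriveE.
Qed.

(** In coordinates the chain rule writes each derivative of the composite as a
    sum of products of an entry of a derivative of h with a partial derivative
    of f composed with h, to which the induction on k applies. *)
Lemma Ck_on_comp (V : normedModType R) d k (O : set V) (O' : set 'rV[R]_d)
    (W : normedModType R) (h : V -> 'rV[R]_d) (f : 'rV[R]_d -> W) :
  open O -> (forall x, O x -> O' (h x)) ->
  Ck_on k O h -> Ck_on k O' f -> Ck_on k O (f \o h).
Proof.
move=> Oo hO; elim: k f => [|k IH] f Ch Cf.
  by move=> x Ox; apply: continuous_comp; [exact: Ch|exact/Cf/hO].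
have [[dh Dh] [df Df]] := (Ch, Cf).
split=> [x Ox|v].
  by apply: differentiable_comp; [exact: dh|exact/df/hO].
apply: (Ck_on_eq (f := fun x => \sum_j
    ('D_v h x) 0 j *: 'D_(delta_mx 0 j) f (h x))) => //.
  move=> x Ox; rewrite [RHS]derive_comp; [|exact: dh|exact/df/hO].
  by rewrite [RHS]derive_basis//; exact/df/hO.
apply: Ck_on_sum => // j; apply: Ck_onZ => //; first exact: (@Ck_on_rV _ _ _ _ _ Oo).1 (Dh v) j.
exact: IH (Ck_onW Ch) (Df _).
Qed.

Lemma is_derive_sqrtV (t : R) : 0 < t ->
  is_derive t 1 (fun t : R => (Num.sqrt t)^-1)
    (- (2%:R)^-1 * (Num.sqrt t)^-1 ^+ 3).
Proof.
move=> t0; have s0 : Num.sqrt t != 0 by rewrite gt_eqF// sqrtr_gt0.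
have ds := is_derive1_sqrt t0.
apply: DeriveDef; first exact: derivableV.
rewrite deriveV//.
rewrite derive_val /GRing.scale /= expr2.
by field.
Qed.

(** The induction on k closes because the derivative of f^(-1/2) is polynomial
    in f^(-1/2) itself and the derivative of f. *)
Lemma Ck_on_sqrtV (V : normedModType R) k (O : set V) (f : V -> R) :
  open O -> (forall x, O x -> 0 < f x) ->
  Ck_on k O f -> Ck_on k O (fun x => (Num.sqrt (f x))^-1).
Proof.
move=> Oo f0.
have ds x : O x -> differentiable (fun t : R => (Num.sqrt t)^-1) (f x).
  by move=> /f0 /is_derive_sqrtV[/derivable1_diffP].
elim: k => [|k IH] Cf.
  move=> x Ox; apply: (@continuous_comp _ _ _ f (fun t : R => (Num.sqrt t)^-1)).
    exact: Cf.
  exact/differentiable_continuous/ds.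
have [df Df] := Cf; have Cs := IH (Ck_onW Cf); split=> [x Ox|v].
  apply: (@differentiable_comp _ _ _ _ f (fun t : R => (Num.sqrt t)^-1)).
    exact: df.
  exact: ds.
apply: (Ck_on_eq (f := fun x => 'D_v f x *
    (- (2%:R)^-1 * \prod_(i < 3) (Num.sqrt (f x))^-1))) => //.
  move=> x Ox; rewrite prodr_const card_ord.
  rewrite (@derive_comp _ _ _ f (fun t : R => (Num.sqrt t)^-1)) //; last 2 first.
    exact: df.
    exact: ds.
  rewrite [RHS]deriveE; last exact: ds.
  rewrite -[X in _ = 'd _ _ X]mulr1 [RHS]linearZ /= -deriveE; last exact: ds.
  by have [_ ->] := is_derive_sqrtV (f0 _ Ox).
apply: Ck_onM => //; first exact: Df.
by apply: Ck_onM => //; [exact: Ck_on_cst|exact: Ck_on_prod].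
Qed.

End CkCalculus.

(** * Symmetry of second derivatives *)

Section SecondDerivatives.
Context {R : realType} {V : normedModType R}.
Implicit Types (f : V -> R) (a u v : V) (s t h : R).

Lemma is_derive_line f a u s : differentiable f (a + s *: u) ->
  is_derive s 1 (fun s => f (a + s *: u)) ('D_u f (a + s *: u)).
Proof.
move=> df; pose l s : V := a + s *: u.
have dl : differentiable l s.
  by apply: differentiableD => //; exact: differentiableZl.
have Dl : 'D_1 l s = u.
  rewrite /l deriveD//; last exact/diff_derivable/differentiableZl.
  rewrite derive_cst add0r deriveE; last exact: differentiableZl.
  by rewrite diffZl//= diff_val scale1r.
apply: DeriveDef; first by apply/derivable1_diffP/(differentiable_comp dl).
by rewrite (derive_comp (h := l))// Dl.
Qed.

Lemma MVT_line f a u h : 0 < h ->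
  (forall s, 0 <= s <= h -> differentiable f (a + s *: u)) ->
  exists2 s, 0 <= s <= h & f (a + h *: u) - f a = h * 'D_u f (a + s *: u).
Proof.
move=> h0 df.
have [||c ch] := @MVT R (fun s => f (a + s *: u))
  (fun s => 'D_u f (a + s *: u)) 0 h h0.
- move=> s sh; apply/is_derive_line/df.
  by rewrite !ltW ?(itvP sh).
- apply: continuous_in_subspaceT => s; rewrite inE /= => sh.
  have /is_derive_line [+ _] : differentiable f (a + s *: u).
    by apply: df; rewrite !(itvP sh).
  by move=> /derivable1_diffP/differentiable_continuous.
- by rewrite scale0r addr0 subr0 mulrC => E; exists c; rewrite ?ltW ?(itvP ch).
Qed.

(** The mean value theorem along u for y |-> f(y + hv) - f(y), then along v for
    the derivative of f along u. *)
Lemma second_difference_mean (O : set V) f x u v h : 0 < h ->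
  (forall s t, 0 <= s <= h -> 0 <= t <= h -> O (x + s *: u + t *: v)) ->
  Ck_on 2 O f ->
  exists s t, [/\ 0 <= s <= h, 0 <= t <= h &
    f (x + h *: u + h *: v) - f (x + h *: u) - (f (x + h *: v) - f x) =
    h ^+ 2 * 'D_v (fun y => 'D_u f y) (x + s *: u + t *: v)].
Proof.
move=> h0 box [df Df].
have hh : 0 <= h <= h by rewrite lexx ltW.
have zh : 0 <= (0 : R) <= h by rewrite lexx ltW.
pose F y := f (y + h *: v) - f y.
have dsft y : differentiable (fun y => y + h *: v) y.
  by apply: (@differentiableD _ _ _ id (cst (h *: v))).
have Dsft y : 'D_u (fun y => y + h *: v) y = u.
  rewrite (@deriveD _ _ _ id (cst (h *: v))) ?derive_id ?derive_cst ?addr0//.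
have dsh s : 0 <= s <= h -> differentiable (fun y => f (y + h *: v)) (x + s *: u).
  move=> sh; apply: (@differentiable_comp _ _ _ _ (fun y => y + h *: v) f).
    exact: dsft.
  exact/df/box.
have dfs s : 0 <= s <= h -> differentiable f (x + s *: u).
  by move=> sh; rewrite -[_ + _]addr0 -[X in _ + X](scale0r v); apply/df/box.
have [s sh] := @MVT_line F x u h h0 (fun s sh =>
  differentiableB (dsh s sh) (dfs s sh)).
rewrite /F deriveB; [|exact/diff_derivable/dsh|exact/diff_derivable/dfs].
rewrite (@derive_comp _ _ _ _ (fun y => y + h *: v) f)//; last exact/df/box.
rewrite Dsft => ->.
have [t th ->] := @MVT_line (fun y => 'D_u f y) (x + s *: u) v h h0 (fun t th =>
  (Df u).1 _ (box s t sh th)).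
by exists s, t; split=> //; rewrite mulrA.
Qed.

Lemma continuous_eq_near (P Q : V -> R) x :
  {for x, continuous P} -> {for x, continuous Q} ->
  (forall d, 0 < d -> exists y z, [/\ ball x d y, ball x d z & P y = Q z]) ->
  P x = Q x.
Proof.
move=> cP cQ PQ; apply/eqP; rewrite -subr_eq0 -normr_le0.
apply/ler_addgt0Pr => e e0; rewrite add0r.
have e2 : 0 < e / 2%:R by rewrite divr_gt0.
have /nbhs_ballP[d /= d0 dP] : nbhs x
    ([set y | `|P x - P y| <= e / 2%:R] `&` [set y | `|Q x - Q y| <= e / 2%:R]).
  by apply: filterI; [move/cvgrPdist_le: cP|move/cvgrPdist_le: cQ]; exact.
have [y [z [/dP[/= Py _] /dP[_ /= Qz] E]]] := PQ d d0.
rewrite (splitr e) -(subrKA (P y)) (le_trans (ler_normD _ _))//.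
by rewrite lerD// E distrC.
Qed.

(** The second difference of f over a small parallelogram is, by the mean value
    theorem used once in each direction, h^2 times either mixed derivative at
    nearby points; continuity of both then identifies them. *)
Lemma derive_swap (O : set V) f x u v : open O -> O x -> Ck_on 2 O f ->
  'D_u (fun y => 'D_v f y) x = 'D_v (fun y => 'D_u f y) x.
Proof.
move=> Oo Ox Cf; have [_ Df] := Cf; apply/esym.
apply: continuous_eq_near ((Df u).2 v _ Ox) ((Df v).2 u _ Ox) _ => d0 d0_gt0.
have /nbhs_ballP[d /= d_gt0 dP] : nbhs x (O `&` ball x d0).
  by apply: filterI; [exact: nbhs_open|exact: nbhsx_ballx].
have [h h0 box] : exists2 h, 0 < h & forall s t,
    0 <= s <= h -> 0 <= t <= h -> ball x d (x + s *: u + t *: v).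
  have N0 : 0 < `|u| + `|v| + 1 by rewrite ltr_wpDl.
  exists (d / (`|u| + `|v| + 1)) => [|s t]; first by rewrite divr_gt0.
  set h := d / _ => /andP[s0 sh] /andP[t0 th].
  rewrite -ball_normE /= -addrA opprD addNKr normrN.
  rewrite (le_lt_trans (ler_normD _ _))// !normrZ !ger0_norm//.
  apply: (@le_lt_trans _ _ (h * (`|u| + `|v|))).
    by rewrite mulrDr lerD// ler_wpM2r.
  by rewrite /h mulrAC ltr_pdivrMr// ltr_pM2l// ltrDl.
have [|s [t [sh th E1]]] := @second_difference_mean O f x u v h h0 _ Cf.
  by move=> s t sh th; exact: (dP _ (box s t sh th)).1.
have [|t' [s' [th' sh' E2]]] := @second_difference_mean O f x v u h h0 _ Cf.
  by move=> s' t' sh' th'; rewrite addrAC; exact: (dP _ (box _ _ th' sh')).1.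
have Df2 : f (x + h *: u + h *: v) - f (x + h *: u) - (f (x + h *: v) - f x) =
           f (x + h *: v + h *: u) - f (x + h *: v) - (f (x + h *: u) - f x).
  rewrite [x + h *: v + _]addrAC !opprB addrACA [RHS]addrACA; congr (_ + _).
  exact: addrC.
exists (x + s *: u + t *: v), (x + t' *: v + s' *: u); split.
- exact: (dP _ (box _ _ sh th)).2.
- by rewrite addrAC; exact: (dP _ (box _ _ sh' th')).2.
- have h2 : h ^+ 2 != 0 by rewrite expf_neq0 ?gt_eqF.
  exact: (mulfI h2 (etrans (esym E1) (etrans Df2 E2))).
Qed.

End SecondDerivatives.

(** * Vector fields in the kernel of a Jacobian *)

Section SmoothMatrices.
Context {R : realType} {V : normedModType R} (O : set V).
Hypothesis Oo : open O.

Definition smooth_mx m n (A : V -> 'M[R]_(m, n)) : Prop :=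
  forall i j, smooth_on O (fun x => A x i j : R).

Lemma smooth_mx_cst m n (A : 'M[R]_(m, n)) : smooth_mx (fun=> A).
Proof. by move=> i j k; exact: Ck_on_cst. Qed.

Lemma smooth_mxM m n p (A : V -> 'M[R]_(m, n)) (B : V -> 'M[R]_(n, p)) :
  smooth_mx A -> smooth_mx B -> smooth_mx (fun x => A x *m B x).
Proof.
move=> As Bs i j k; under eq_fun do rewrite mxE.
by apply: Ck_on_sum => // l; apply: Ck_onM; [exact: Oo|exact: As|exact: Bs].
Qed.

Lemma smooth_det n (A : V -> 'M[R]_n) :
  smooth_mx A -> smooth_on O (fun x => \det (A x)).
Proof.
move=> As k; rewrite /determinant; apply: Ck_on_sum => // s.
apply: Ck_onM => //; first exact: Ck_on_cst.
by apply: Ck_on_prod => // i; exact: As.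
Qed.

Lemma smooth_adj n (A : V -> 'M[R]_n) :
  smooth_mx A -> smooth_mx (fun x => \adj (A x)).
Proof.
move=> As i j k; under eq_fun do rewrite mxE /cofactor.
apply: Ck_onM => //; first exact: Ck_on_cst.
apply: smooth_det => a b l; under eq_fun do rewrite !mxE.
exact: As.
Qed.

End SmoothMatrices.

Section KernelFields.
Context {R : realType} {d : nat}.
Implicit Types (O : set 'rV[R]_d) (u v : 'rV[R]_d -> 'rV[R]_d) (x w : 'rV[R]_d).

(** The Leibniz rule for the pairing of df with v: one term differentiates v,
    the other freezes v at x. *)
Lemma derive_along O (f : 'rV[R]_d -> R) v x w : open O -> O x ->
  Ck_on 2 O f -> Ck_on 1 O v ->
  'D_w (fun y => 'D_(v y) f y) x =
  'D_('D_w v x) f x + 'D_w (fun y => 'D_(v x) f y) x.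
Proof.
move=> Oo Ox [df Df] [dv _].
have Dsum (c : 'rV[R]_d -> 'rV[R]_d) : differentiable c x ->
    'D_w (fun y => 'D_(c y) f y) x =
    \sum_j ('D_w c x 0 j * 'D_(delta_mx 0 j) f x +
            c x 0 j * 'D_w (fun y => 'D_(delta_mx 0 j) f y) x).
  move=> dc.
  have dcf j := scale_fun_derive (differentiable_entry j dc)
    ((Df (delta_mx 0 j)).1 _ Ox).
  rewrite (near_eq_derive (g := \sum_j
      (fun y => c y 0 j *: 'D_(delta_mx 0 j) f y : R))).
    rewrite derive_sum => [|j]; last exact/diff_derivable/(dcf j).1.
    apply: eq_bigr => j _; rewrite (dcf j).2 -derive_rV//.
    exact: diff_derivable.
  apply: filterS (nbhs_open Oo Ox) => y Oy.
  by rewrite fct_sumE derive_basis//; exact: df.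
rewrite (Dsum v (dv x Ox)) (Dsum (cst (v x)) (differentiable_cst _ _)).
rewrite (derive_basis ('D_w v x) (df x Ox)) big_split/=.
rewrite [X in _ = _ + X]big_split/=; congr (_ + _).
rewrite [X in _ = X + _]big1 ?add0r// => j _.
by rewrite derive_cst mxE mul0r.
Qed.

(** Differentiating df(v) = 0 along u gives df(D_u v) = - d^2f(u, v), and the
    right-hand side is symmetric in u and v. *)
Lemma kernel_involutive O (f : 'rV[R]_d -> R) u v x : open O -> O x ->
  smooth_on O f -> smooth_on O u -> smooth_on O v ->
  (forall y, O y -> 'D_(u y) f y = 0) -> (forall y, O y -> 'D_(v y) f y = 0) ->
  'D_('D_(u x) v x - 'D_(v x) u x) f x = 0.
Proof.
move=> Oo Ox sf su sv fu fv.
have zero c w : (forall y, O y -> 'D_(c y) f y = 0) ->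
    'D_w (fun y => 'D_(c y) f y) x = 0.
  move=> fc; rewrite (near_eq_derive (g := cst 0)) ?derive_cst//.
  by apply: filterS (nbhs_open Oo Ox) => y; exact: fc.
have := derive_along (u x) Oo Ox (sf 2) (sv 1%N).
have := derive_along (v x) Oo Ox (sf 2) (su 1%N).
have df : differentiable f x by exact: (sf 1%N).1.
rewrite (zero v (u x) fv) (zero u (v x) fu) (derive_swap (v x) (u x) Oo Ox (sf 2)).
rewrite deriveE// [in X in _ -> X]deriveE// [in X in _ -> _ -> X]deriveE// linearB/=.
by move=> /esym/eqP; rewrite addr_eq0 => /eqP -> /esym/eqP;
  rewrite addr_eq0 => /eqP ->; rewrite opprK addNr.
Qed.

(** With A the Jacobian of F and S a right inverse of it at x, Cramer's rule
    makes w |-> det(SA) w - w A adj(SA) S a map into ker A at every point, which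
    is polynomial in A and the identity on the kernel at x. *)
Lemma kernel_field n O (F : 'rV[R]_d -> 'rV[R]_n) x w : open O -> O x ->
  smooth_on O F -> (forall z, exists e, 'D_e F x = z) -> 'D_w F x = 0 ->
  exists u, [/\ smooth_on O u, u x = w & forall y, O y -> 'D_(u y) F y = 0].
Proof.
move=> Oo Ox sF surj Fw.
have sFk k : smooth_on O (fun y => F y 0 k : R).
  by move=> l; exact: (@Ck_on_rV _ _ _ _ _ _ Oo).1 (sF l) k.
pose A y : 'M[R]_(d, n) :=
  \matrix_(j, k) 'D_(delta_mx 0 j) (fun z => F z 0 k : R) y.
have sA : smooth_mx O A.
  by move=> j k l; under eq_fun do rewrite mxE; exact: (sFk k l.+1).2.
have AE y e : O y -> 'D_e F y = e *m A y.
  move=> Oy; have dF : differentiable F y by exact: (sF 1%N).1.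
  apply/rowP => k; rewrite derive_rV; last exact: diff_derivable.
  rewrite derive_basis ?mxE; last exact: differentiable_entry.
  by apply: eq_bigr => j _; rewrite mxE.
have [s sP] := choice (fun k : 'I_n => surj (delta_mx 0 k)).
pose S : 'M[R]_(n, d) := \matrix_k s k.
have SA : S *m A x = 1%:M.
  by apply/row_matrixP => k; rewrite row_mul rowK -AE// sP row1.
pose u y := \det (S *m A y) *: w - w *m A y *m \adj (S *m A y) *m S.
exists u; split=> [l||y Oy].
- apply: (@Ck_on_rV _ _ _ _ _ _ Oo).2 => j.
  have sSA : smooth_mx O (fun y => S *m A y).
    by apply: smooth_mxM => //; exact: smooth_mx_cst.
  have sw : smooth_mx O (fun y => w *m A y *m \adj (S *m A y) *m S).
    apply: smooth_mxM => //; last exact: smooth_mx_cst.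
    apply: smooth_mxM => //; last exact: smooth_adj.
    by apply: smooth_mxM => //; exact: smooth_mx_cst.
  apply: (Ck_on_eq (f := fun y => \det (S *m A y) * w 0 j +
    (-1) * (w *m A y *m \adj (S *m A y) *m S) 0 j)) => //.
    by move=> y _; rewrite mulN1r !mxE.
  apply: Ck_onD => //; apply: Ck_onM => //; try exact: Ck_on_cst.
    exact: smooth_det.
  exact: sw.
- by rewrite /u SA det1 scale1r -AE// Fw !mul0mx subr0.
- rewrite AE// /u mulmxBl -!mulmxA mul_adj_mx !mulmxA.
  by rewrite -scalemxAl mul_mx_scalar subrr.
Qed.

End KernelFields.

(** * Smooth functions on a manifold *)

Section Charts.
Context {R : realType} {n : nat} (M : manifold R n).
Implicit Types (p q : M) (phi psi : chart R n M).

Local Notation coord := Defs.coord.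
Local Notation cp p := (coord (chart_at p)).

Lemma coordK phi p : atlas phi -> dom phi p -> param phi (coord phi p) = p.
Proof. by move=> /atlas_chart[_ _ + _ _]; exact. Qed.

Lemma dom_open phi : atlas phi -> open (dom phi).
Proof. by move=> /atlas_chart[]. Qed.

Lemma near_dom phi p : atlas phi -> dom phi p -> \forall q \near p, dom phi q.
Proof. by move=> /dom_open; exact: nbhs_open. Qed.

Lemma coord_cont phi p : atlas phi -> dom phi p -> {for p, continuous (coord phi)}.
Proof. by move=> /atlas_chart[_ _ _ + _]; exact. Qed.

Lemma param_cont phi p : atlas phi -> dom phi p ->
  {for coord phi p, continuous (param phi)}.
Proof. by move=> /atlas_chart[_ _ _ _ +] pp; apply; exists p. Qed.

Lemma near_param phi p (P : M -> Prop) : atlas phi -> dom phi p ->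
  (\forall q \near p, P q) -> \forall x \near coord phi p, P (param phi x).
Proof. by move=> Aphi pp nP; apply: (param_cont Aphi pp); rewrite coordK. Qed.

Lemma near_coord phi p (P : 'rV[R]_n -> Prop) : atlas phi -> dom phi p ->
  (\forall x \near coord phi p, P x) -> \forall q \near p, P (coord phi q).
Proof. by move=> Aphi pp; exact: (coord_cont Aphi pp). Qed.

Lemma open_coord phi (O : set M) : atlas phi -> open O ->
  open (coord phi @` (O `&` dom phi)).
Proof.
move=> Aphi Oo; rewrite openE => _ [q [Oq qphi] <-].
have [_ iphi _ _ _] := atlas_chart Aphi.
have H : \forall x \near coord phi q, (coord phi @` dom phi) x.
  by apply: nbhs_open => //; exists q.
apply: filterS (filterI H (near_param Aphi qphi (nbhs_open Oo Oq))).
move=> _ [[q' q'phi <-]]; rewrite coordK// => Oq'.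
by exists q'.
Qed.

Lemma near_paramK phi p : atlas phi -> dom phi p ->
  \forall x \near coord phi p, coord phi (param phi x) = x.
Proof.
move=> Aphi pphi; have [_ iphi _ _ _] := atlas_chart Aphi.
have H : \forall x \near coord phi p, (coord phi @` dom phi) x.
  by apply: nbhs_open => //; exists p.
by apply: filterS H => _ [q qphi <-]; rewrite coordK.
Qed.

Lemma transition_smooth phi psi : atlas phi -> atlas psi ->
  smooth_on (coord phi @` (dom psi `&` dom phi)) (coord psi \o param phi).
Proof. by rewrite setIC; exact: atlas_compatible. Qed.

Lemma transition_differentiable phi psi q : atlas phi -> atlas psi ->
  dom phi q -> dom psi q -> differentiable (coord psi \o param phi) (coord phi q).
Proof.
move=> Aphi Apsi qphi qpsi.
by apply: (transition_smooth Aphi Apsi 1).1; exists q.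
Qed.

(** Transition maps are smooth, so that smoothness in one chart suffices. *)
Lemma smooth_near_chart (W : normedModType R) phi (U : set 'rV[R]_n) p (f : M -> W) :
  atlas phi -> dom phi p -> open U -> U (coord phi p) ->
  smooth_on U (f \o param phi) -> smooth_near p f.
Proof.
move=> Aphi pphi Uo Up sf.
pose O := [set q | dom phi q /\ U (coord phi q)].
have Oo : open O.
  rewrite openE => q [qphi Uq]; apply: filterI; first exact: near_dom.
  exact/(near_coord Aphi qphi)/nbhs_open.
exists O; split=> // psi Apsi k.
have So : open (coord psi @` (O `&` dom psi)) by exact: open_coord.
apply: (@Ck_on_eq _ _ _ _ _ ((f \o param phi) \o (coord phi \o param psi)) _ So).
  by move=> _ [q [[qphi _] qpsi] <-] /=; rewrite (coordK Apsi)// coordK.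
apply: (Ck_on_comp So _ _ (sf k)).
  by move=> _ [q [[qphi Uq] qpsi] <-] /=; rewrite (coordK Apsi).
apply: Ck_on_sub (transition_smooth Apsi Aphi k) => _ [q [[qphi _] qpsi] <-].
by exists q.
Qed.

Lemma smooth_near_inv (W : normedModType R) phi p (f : M -> W) :
  atlas phi -> dom phi p -> smooth_near p f ->
  exists U, [/\ open U, U (coord phi p) & smooth_on U (f \o param phi)].
Proof.
move=> Aphi pphi [U [Uo Up sf]]; exists (coord phi @` (U `&` dom phi)).
by split; [exact: open_coord|exists p|exact: sf].
Qed.

Lemma smooth_near_near (W : normedModType R) p (f : M -> W) :
  smooth_near p f -> \forall q \near p, smooth_near q f.
Proof.
move=> [U [Uo Up sf]]; apply: filterS (nbhs_open Uo Up) => q Uq.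
by exists U.
Qed.

Lemma smooth_near_differentiable (W : normedModType R) phi p (f : M -> W) :
  atlas phi -> dom phi p -> smooth_near p f ->
  differentiable (f \o param phi) (coord phi p).
Proof.
by move=> Aphi pphi /(smooth_near_inv Aphi pphi)[U [Uo Up /(_ 1%N)[+ _]]]; exact.
Qed.

Lemma smooth_near_eq (W : normedModType R) p (f g : M -> W) :
  (\forall q \near p, f q = g q) -> smooth_near p f -> smooth_near p g.
Proof.
move=> fg [U [Uo Up sf]].
exists (U `&` interior [set q | f q = g q]); split.
- by apply: openI => //; exact: open_interior.
- by split.
move=> phi Aphi k; apply: (@Ck_on_eq _ _ _ _ _ (f \o param phi)).
- by apply: open_coord => //; apply: openI => //; exact: open_interior.
- move=> _ [q [[_ /interior_subset fgq] qphi] <-] /=; by rewrite coordK.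
- by apply: Ck_on_sub (sf phi Aphi k); apply: image_subset; apply: setSI => ? [].
Qed.

Lemma smooth_near_cst (W : normedModType R) p (a : W) : smooth_near p (fun _ : M => a).
Proof.
by exists setT; split; [exact: openT| |move=> phi _ k; exact: Ck_on_cst].
Qed.

Lemma smooth_nearD (W : normedModType R) p (f g : M -> W) :
  smooth_near p f -> smooth_near p g -> smooth_near p (fun q => f q + g q).
Proof.
move=> [U [Uo Up sf]] [U' [Uo' Up' sg]].
exists (U `&` U'); split=> [||phi Aphi k]; [exact: openI|by []|].
have So : open (coord phi @` ((U `&` U') `&` dom phi)).
  by apply: open_coord => //; exact: openI.
apply: Ck_onD => //.
- by apply: Ck_on_sub (sf phi Aphi k); apply: image_subset; apply: setSI => ? [].
- by apply: Ck_on_sub (sg phi Aphi k); apply: image_subset; apply: setSI => ? [].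
Qed.

Lemma smooth_nearZ (W : normedModType R) p (f : M -> R) (g : M -> W) :
  smooth_near p f -> smooth_near p g -> smooth_near p (fun q => f q *: g q).
Proof.
move=> [U [Uo Up sf]] [U' [Uo' Up' sg]].
exists (U `&` U'); split=> [||phi Aphi k]; [exact: openI|by []|].
have So : open (coord phi @` ((U `&` U') `&` dom phi)).
  by apply: open_coord => //; exact: openI.
apply: Ck_onZ => //.
- by apply: Ck_on_sub (sf phi Aphi k); apply: image_subset; apply: setSI => ? [].
- by apply: Ck_on_sub (sg phi Aphi k); apply: image_subset; apply: setSI => ? [].
Qed.

Lemma smooth_near_continuous (W : normedModType R) p (f : M -> W) :
  smooth_near p f -> {for p, continuous f}.
Proof.
move=> sf; have pp := mem_chart_at p; have Ap := atlas_chart_at p.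
have fE : \forall q \near p, (f \o param (chart_at p)) (cp p q) = f q.
  by apply: filterS (near_dom Ap pp) => q qp /=; rewrite coordK.
apply: cvg_trans (near_eq_cvg fE) _; rewrite -[f p](nbhs_singleton fE).
apply: (@continuous_comp _ _ _ (cp p)); first exact: coord_cont.
exact/differentiable_continuous/smooth_near_differentiable.
Qed.

Lemma smooth_near_sqrtV p (f : M -> R) :
  smooth_near p f -> 0 < f p -> smooth_near p (fun q => (Num.sqrt (f q))^-1).
Proof.
move=> sf f0; have [U [Uo Up sU]] := sf.
have fpos : \forall q \near p, 0 < f q.
  exact: (cvgr_gt (f p) (smooth_near_continuous sf) _ f0).
pose U' := U `&` interior [set q | 0 < f q].
have Uo' : open U' by apply: openI => //; exact: open_interior.
exists U'; split=> // phi Aphi k; apply: Ck_on_sqrtV.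
- exact: open_coord.
- by move=> _ [q [[_ /interior_subset fq] qphi] <-] /=; rewrite coordK.
- by apply: Ck_on_sub (sU phi Aphi k); apply: image_subset; apply: setSI => ? [].
Qed.

End Charts.

(** * Tangent vectors and smooth vector fields *)

Section TangentVectors.
Context {R : realType} {n : nat} (M : manifold R n).
Implicit Types (p q : M) (phi psi : chart R n M) (X Y : M -> 'rV[R]_n).

Local Notation coord := Defs.coord.
Local Notation cp p := (coord (chart_at p)).

Lemma coord_smooth phi p : atlas phi -> dom phi p -> smooth_near p (coord phi).
Proof.
move=> Aphi pphi; apply: (smooth_near_chart Aphi pphi (open_coord Aphi openT)).
  by exists p.
by rewrite setTI -[dom phi]setIid; exact: transition_smooth.
Qed.

Lemma tder_near_eq (W : normedModType R) p (f g : M -> W) v :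
  (\forall q \near p, f q = g q) -> tder f p v = tder g p v.
Proof.
move=> fg; apply: near_eq_derive.
exact: (near_param (atlas_chart_at p) (mem_chart_at p) fg).
Qed.

Lemma tder_cst (W : normedModType R) p (a : W) v : tder (fun _ : M => a) p v = 0.
Proof. by rewrite /tder derive_cst. Qed.

Lemma tder_linear (W : normedModType R) p (f : M -> W) :
  smooth_near p f -> linear (tder f p).
Proof.
move=> sf; apply: derive_linear; apply: smooth_near_differentiable sf.
  exact: atlas_chart_at.
exact: mem_chart_at.
Qed.

(** The chain rule through an arbitrary chart around the image point; the chart
    at the image point itself need not be a convenient one. *)
Lemma tder_comp m (N : manifold R m) (F : M -> N) (W : normedModType R)
    (f : N -> W) (phi : chart R m N) p v : atlas phi -> dom phi (F p) ->
  {for p, continuous F} -> smooth_near p (coord phi \o F) ->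
  smooth_near (F p) f ->
  tder (f \o F) p v =
    'D_(tder (coord phi \o F) p v) (f \o param phi) (coord phi (F p)).
Proof.
move=> Aphi Fphi Fc sF sf; have Ap := atlas_chart_at p; have pp := mem_chart_at p.
pose h := coord phi \o F \o param (chart_at p).
have hp : h (cp p p) = coord phi (F p) by rewrite /h /= coordK.
rewrite -[in RHS]hp -[RHS]derive_comp; last 2 first.
- exact: smooth_near_differentiable sF.
- by rewrite hp; exact: smooth_near_differentiable sf.
apply: near_eq_derive.
have H : \forall q \near p, (f \o F) q = f (param phi (coord phi (F q))).
  have nF : \forall q \near p, dom phi (F q).
    exact: (Fc (dom phi) (near_dom Aphi Fphi)).
  by apply: filterS nF => q Fq /=; rewrite coordK.
exact: near_param H.
Qed.

Lemma tder_chart (W : normedModType R) (f : M -> W) phi p v :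
  atlas phi -> dom phi p -> smooth_near p f ->
  tder f p v = 'D_(tder (coord phi) p v) (f \o param phi) (coord phi p).
Proof.
move=> Aphi pphi sf; apply: (@tder_comp n M id W f phi p v) => //.
exact: coord_smooth.
Qed.

Lemma tder_coord_at p v : tder (cp p) p v = v.
Proof.
rewrite /tder (near_eq_derive (g := id)) ?derive_id//.
by apply: near_paramK; [exact: atlas_chart_at|exact: mem_chart_at].
Qed.

(** The tangent vector at p whose components in [phi] are w. *)
Definition tangent_of phi p (w : 'rV[R]_n) : 'rV[R]_n :=
  'D_w (cp p \o param phi) (coord phi p).

Lemma tder_coordK phi p v : atlas phi -> dom phi p ->
  tangent_of phi p (tder (coord phi) p v) = v.
Proof.
move=> Aphi pphi; rewrite -[RHS](tder_coord_at p) [RHS](tder_chart _ Aphi pphi)//.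
by apply: coord_smooth; [exact: atlas_chart_at|exact: mem_chart_at].
Qed.

Lemma tangent_ofK phi p w : atlas phi -> dom phi p ->
  tder (coord phi) p (tangent_of phi p w) = w.
Proof.
move=> Aphi pphi; have Ap := atlas_chart_at p; have pp := mem_chart_at p.
rewrite /tangent_of /tder.
pose h := cp p \o param phi.
have hp : h (coord phi p) = cp p p by rewrite /h /= coordK.
rewrite -hp -(derive_comp (h := h)); last 2 first.
- exact: transition_differentiable.
- by rewrite hp; exact: transition_differentiable.
rewrite (near_eq_derive (g := id)) ?derive_id//.
have H : \forall q \near p, coord phi (param (chart_at p) (cp p q)) = coord phi q.
  by apply: filterS (near_dom Ap pp) => q qp; rewrite coordK.
by apply: filterS2 (near_param Aphi pphi H) (near_paramK Aphi pphi) => x /= -> ->.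
Qed.

Lemma tder_coord_inj phi p v : atlas phi -> dom phi p ->
  tder (coord phi) p v = 0 -> v = 0.
Proof.
move=> Aphi pphi v0; rewrite -(tder_coordK v Aphi pphi) v0.
rewrite /tangent_of deriveE ?linear0//.
by apply: transition_differentiable => //;
  [exact: atlas_chart_at|exact: mem_chart_at].
Qed.

Lemma near_chart p : \forall q \near p, dom (chart_at p) q.
Proof. by apply: near_dom; [exact: atlas_chart_at|exact: mem_chart_at]. Qed.

Lemma components_at p X : components p X p = X p.
Proof. exact: tder_coord_at. Qed.

Lemma smooth_field_eq p X Y :
  (\forall q \near p, X q = Y q) -> smooth_field p X -> smooth_field p Y.
Proof.
by move=> XY; apply: smooth_near_eq; apply: filterS XY => q; rewrite /components => ->.
Qed.

Lemma smooth_field_linear p (f : M -> R) X Y : smooth_near p f ->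
  smooth_field p X -> smooth_field p Y ->
  smooth_field p (fun q => f q *: X q + Y q).
Proof.
move=> sf sX sY.
apply: smooth_near_eq (smooth_nearD (smooth_nearZ sf sX) sY).
apply: filterS (near_chart p) => q qp; rewrite /components.
by rewrite tder_linear//; apply: coord_smooth => //; exact: atlas_chart_at.
Qed.

Lemma smooth_field0 p : smooth_field p (fun=> 0).
Proof.
apply: smooth_near_eq (smooth_near_cst p 0).
by apply: filterE => q; rewrite /components /tder derive0.
Qed.

Lemma smooth_fieldZ p (f : M -> R) X : smooth_near p f -> smooth_field p X ->
  smooth_field p (fun q => f q *: X q).
Proof.
move=> sf sX; apply: smooth_field_eq (smooth_field_linear sf sX (smooth_field0 p)).
by apply: filterE => q; rewrite addr0.
Qed.

Lemma smooth_fieldD p X Y : smooth_field p X -> smooth_field p Y ->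
  smooth_field p (fun q => X q + Y q).
Proof.
move=> sX sY; have s1 : smooth_near p (fun _ : M => 1 : R) by exact: smooth_near_cst.
apply: smooth_field_eq (smooth_field_linear s1 sX sY).
by apply: filterE => q; rewrite scale1r.
Qed.

Lemma smooth_fieldB p X Y : smooth_field p X -> smooth_field p Y ->
  smooth_field p (fun q => X q - Y q).
Proof.
move=> sX sY; have s1 : smooth_near p (fun _ : M => -1 : R) by exact: smooth_near_cst.
apply: smooth_field_eq (smooth_field_linear s1 sY sX).
by apply: filterE => q; rewrite scaleN1r addrC.
Qed.

Lemma smooth_field_sum p (I : Type) (s : seq I) (X : I -> M -> 'rV[R]_n) :
  (forall i, smooth_field p (X i)) ->
  smooth_field p (fun q => \sum_(i <- s) X i q).
Proof.
move=> sX; elim: s => [|i s IH].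
  by under eq_fun do rewrite big_nil; exact: (smooth_field0 p).
by under eq_fun do rewrite big_cons; exact: (smooth_fieldD (sX i) IH).
Qed.

Lemma field_of_components p (U : set 'rV[R]_n) (u : 'rV[R]_n -> 'rV[R]_n) :
  open U -> U (cp p p) -> smooth_on U u ->
  exists2 X, smooth_field p X &
    \forall q \near p, components p X q = u (cp p q).
Proof.
move=> Uo Up su; have Ap := atlas_chart_at p; have pp := mem_chart_at p.
pose X q := tangent_of (chart_at p) q (u (cp p q)).
have XE : \forall q \near p, components p X q = u (cp p q).
  by apply: filterS (near_chart p) => q qp; exact: tangent_ofK.
exists X => //; apply: (smooth_near_eq (f := u \o cp p)).
  by apply: filterS XE => q.
pose V := U `&` (cp p @` (setT `&` dom (chart_at p))).
have Vo : open V by exact: openI Uo (open_coord Ap openT).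
apply: (smooth_near_chart Ap pp Vo) => [|k]; first by rewrite /V; split=> //; exists p.
apply: (@Ck_on_eq _ _ _ _ _ u) => //.
  by move=> _ [_ [q [_ qp] <-]] /=; rewrite coordK.
by apply: Ck_on_sub (su k) => x [].
Qed.

End TangentVectors.

(** * Linear algebra of a metric *)

Section Metric.
Context {R : realType} {n : nat} (M : manifold R n).
Variable g : M -> 'rV[R]_n -> 'rV[R]_n -> R.
Hypothesis gP : riemannian_metric g.
Implicit Types (p q : M) (u v w : 'rV[R]_n).
Local Notation orthov := Defs.orthov.

Lemma metricC p u v : g p u v = g p v u.
Proof. by have [_ + _ _] := gP; exact. Qed.

Lemma metric_linear p w : linear (g p w : 'rV[R]_n -> R^o).
Proof.
by move=> a u v; have [gl gC _ _] := gP; rewrite gC gl [g p u w]gC [g p v w]gC.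
Qed.

Definition metric_lin p w : {linear 'rV[R]_n -> R^o} :=
  HB.pack (g p w : 'rV[R]_n -> R^o)
    (GRing.isLinear.Build R 'rV[R]_n R^o _ (g p w) (metric_linear p w)).

Lemma metricDr p w u v : g p w (u + v) = g p w u + g p w v.
Proof. exact: (linearD (metric_lin p w)). Qed.
Lemma metricBr p w u v : g p w (u - v) = g p w u - g p w v.
Proof. exact: (linearB (metric_lin p w)). Qed.
Lemma metricNr p w u : g p w (- u) = - g p w u.
Proof. exact: (linearN (metric_lin p w)). Qed.
Lemma metricZr p w a u : g p w (a *: u) = a * g p w u.
Proof. exact: (linearZZ (metric_lin p w) a u). Qed.
Lemma metric0r p w : g p w 0 = 0.
Proof. exact: (linear0 (metric_lin p w)). Qed.
Lemma metric_sumr p w (I : Type) (s : seq I) (f : I -> 'rV[R]_n) :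
  g p w (\sum_(i <- s) f i) = \sum_(i <- s) g p w (f i).
Proof. exact: (linear_sum (metric_lin p w)). Qed.
Lemma metricDl p w u v : g p (u + v) w = g p u w + g p v w.
Proof. by rewrite metricC metricDr ![g p w _]metricC. Qed.
Lemma metricBl p w u v : g p (u - v) w = g p u w - g p v w.
Proof. by rewrite metricC metricBr ![g p w _]metricC. Qed.
Lemma metricNl p w u : g p (- u) w = - g p u w.
Proof. by rewrite metricC metricNr metricC. Qed.
Lemma metricZl p w a u : g p (a *: u) w = a * g p u w.
Proof. by rewrite metricC metricZr metricC. Qed.
Lemma metric0l p w : g p 0 w = 0.
Proof. by rewrite metricC metric0r. Qed.
Lemma metric_suml p w (I : Type) (s : seq I) (f : I -> 'rV[R]_n) :
  g p (\sum_(i <- s) f i) w = \sum_(i <- s) g p (f i) w.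
Proof. by rewrite metricC metric_sumr; apply: eq_bigr => i _; exact: metricC. Qed.

Lemma metric_ge0 p u : 0 <= g p u u.
Proof.
have [->|u0] := eqVneq u 0; first by rewrite metric0l.
by have [_ _ /(_ p u u0)/ltW] := gP.
Qed.

Lemma metric_eq0 p u : g p u u = 0 -> u = 0.
Proof.
have [->//|u0] := eqVneq u 0 => guu.
by have [_ _ /(_ p u u0) + _] := gP; rewrite guu ltxx.
Qed.

Lemma smooth_metric p X Y : smooth_field p X -> smooth_field p Y ->
  smooth_near p (fun q => g q (X q) (Y q)).
Proof. by have [_ _ _] := gP; exact. Qed.

Lemma mem_orthov p (A : {vspace 'rV[R]_n}) w :
  reflect (forall v, v \in A -> g p v w = 0) (w \in orthov g p A).
Proof.
have capE (s : seq 'rV[R]_n) (B : 'rV[R]_n -> {vspace 'rV[R]_n}) :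
    (w \in (\bigcap_(u <- s) B u)%VS) = all (fun u => w \in B u) s.
  elim: s => [|u s IH]; first by rewrite big_nil memvf.
  by rewrite big_cons memv_cap IH.
rewrite /orthov capE; apply: (iffP allP) => [H v vA|H u uA]; last first.
  rewrite memv_ker; apply/eqP; rewrite (lfunE (metric_lin p u)).
  exact/H/vbasis_mem.
rewrite (coord_vbasis vA) metric_suml big1// => i _; rewrite metricZl.
have /H : (vbasis A)`_i \in vbasis A by rewrite mem_nth ?size_tuple.
by rewrite memv_ker => /eqP; rewrite (lfunE (metric_lin p _)) /= => ->; rewrite mulr0.
Qed.

Lemma orthov_cap p (A : {vspace 'rV[R]_n}) : (A :&: orthov g p A)%VS = 0%VS.
Proof.
apply/eqP; rewrite -subv0; apply/subvP => v.
rewrite memv_cap => /andP[vA /mem_orthov/(_ v vA)/metric_eq0 ->].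
exact: mem0v.
Qed.

(** An orthonormal family is free, hence spans when its length is the
    dimension. *)
Lemma orthonormal_expansion p k (A : {vspace 'rV[R]_n}) (e : 'I_k -> 'rV[R]_n) :
  (forall i, e i \in A) -> (forall i j, g p (e i) (e j) = (i == j)%:R) ->
  \dim A = k -> forall v, v \in A -> v = \sum_i g p v (e i) *: e i.
Proof.
move=> eA eo dA v vA.
have coef (c : 'I_k -> R) j : g p (\sum_i c i *: e i) (e j) = c j.
  rewrite metric_suml (bigD1 j)//= metricZl eo eqxx mulr1 big1 ?addr0// => i ij.
  by rewrite metricZl eo (negPf ij) mulr0.
pose X := [tuple e i | i < k].
have XE (i : 'I_k) : X`_i = e i by rewrite -tnth_nth tnth_mktuple.
have fX : free X.
  apply/freeP => c c0 i; rewrite -(coef c i).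
  have := c0; under eq_bigr do rewrite XE.
  by move=> ->; rewrite metric0l.
have XA : (<<X>> <= A)%VS.
  by apply/span_subvP => _ /mapP[i _ ->].
have /eqP AX : (<<X>>%VS == A).
  by move: fX; rewrite eqEdim XA dA /free => /eqP ->; rewrite size_tuple leqnn.
move: vA; rewrite -AX => /coord_span vE.
rewrite {1}vE; apply: eq_bigr => i _; rewrite XE; congr (_ *: _).
rewrite {2}vE; under [X in g p X]eq_bigr do rewrite XE.
by rewrite coef.
Qed.

End Metric.

(** * The vertical distribution *)

Section VerticalDistribution.
Context {R : realType} {d n : nat} (M : manifold R d) (N : manifold R n).
Variable pi : M -> N.
Hypothesis pi_smooth : smooth_map pi.
Implicit Types (p q : M) (X Y : M -> 'rV[R]_d) (v w : 'rV[R]_d).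

Local Notation coord := Defs.coord.
Local Notation cM p := (coord (chart_at p)).
Local Notation piN p := (coord (chart_at (pi p)) \o pi).

Lemma tangent_mapE p v : tangent_map pi p v = tder (piN p) p v.
Proof.
pose F : {linear 'rV[R]_d -> 'rV[R]_n} := HB.pack (tder (piN p) p)
  (GRing.isLinear.Build R 'rV[R]_d 'rV[R]_n _ (tder (piN p) p)
    (tder_linear (pi_smooth.2 p))).
exact: (lfunE F).
Qed.

(** [verts pi q] is defined with the chart at [pi q], which may jump as q
    varies; since the derivative of a transition map is injective, the fixed
    chart at [pi p] has the same kernel and can be differentiated in q. *)
Lemma near_verts p : \forall q \near p, forall v,
  (v \in verts pi q) <-> tder (piN p) q v = 0.
Proof.
have Ap := atlas_chart_at (pi p); have pp := mem_chart_at (pi p).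
have np : \forall q \near p, dom (chart_at (pi p)) (pi q).
  exact: (pi_smooth.1 p (dom (chart_at (pi p))) (near_dom Ap pp)).
apply: filterS np => q qp v.
have Aq := atlas_chart_at (pi q); have qq := mem_chart_at (pi q).
have -> : tder (piN p) q v =
    tder (coord (chart_at (pi p))) (pi q) (tangent_map pi q v).
  rewrite tangent_mapE; apply: tder_comp => //.
  - exact: pi_smooth.1.
  - exact: pi_smooth.2.
  - exact: coord_smooth.
rewrite memv_ker; split=> [/eqP ->|].
  by rewrite /tder deriveE ?linear0//; exact: transition_differentiable.
by move=> /(tder_coord_inj Ap qp) ->.
Qed.

Lemma vertical_in_chart p U : open U -> U (cM p p) ->
  smooth_on U (piN p \o param (chart_at p)) ->
  forall X, (\forall q \near p, X q \in verts pi q) <->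
    \forall q \near p,
    'D_(components p X q) (piN p \o param (chart_at p)) (cM p q) = 0.
Proof.
move=> Uo Up sF X; have Ap := atlas_chart_at p; have pp := mem_chart_at p.
have H : \forall q \near p, (X q \in verts pi q) <->
    'D_(components p X q) (piN p \o param (chart_at p)) (cM p q) = 0.
  have nS := smooth_near_near (pi_smooth.2 p).
  apply: filterS3 (near_verts p) nS (near_chart p) => q qV qs qp.
  by rewrite qV (tder_chart _ Ap qp qs).
by split; apply: filterS2 H => q [].
Qed.

(** The kernel field of [kernel_field] in the chart at p, carried back to M. *)
Lemma vertical_extension p w : limg (tangent_map pi p) = fullv ->
  w \in verts pi p ->
  exists X, [/\ smooth_field p X, X p = w & \forall q \near p, X q \in verts pi q].
Proof.
move=> surj wV; have Ap := atlas_chart_at p; have pp := mem_chart_at p.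
have [U [Uo Up sF]] := smooth_near_inv Ap pp (pi_smooth.2 p).
have tE v : 'D_v (piN p \o param (chart_at p)) (cM p p) = tangent_map pi p v.
  by rewrite tangent_mapE.
have [||u [su uw uV]] := kernel_field (w := w) Uo Up sF.
- move=> z; have : z \in limg (tangent_map pi p) by rewrite surj memvf.
  by move=> /memv_imgP[v _ ->]; exists v; rewrite tE.
- by rewrite tE; apply/eqP; rewrite -memv_ker.
have [X sX XE] := field_of_components Uo Up su.
exists X; split=> //.
  by rewrite -components_at (nbhs_singleton XE).
apply/(vertical_in_chart Uo Up sF).
apply: filterS2 XE (near_coord Ap pp (nbhs_open Uo Up)) => q -> Uq.
exact: uV.
Qed.

Lemma bracket_vertical p X Y : smooth_field p X -> smooth_field p Y ->
  (\forall q \near p, X q \in verts pi q) ->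
  (\forall q \near p, Y q \in verts pi q) -> bracket X Y p \in verts pi p.
Proof.
move=> sX sY vX vY; have Ap := atlas_chart_at p; have pp := mem_chart_at p.
have [U [Uo Up sF]] := smooth_near_inv Ap pp (pi_smooth.2 p).
have [UX [UXo UXp sX']] := smooth_near_inv Ap pp sX.
have [UY [UYo UYp sY']] := smooth_near_inv Ap pp sY.
have inchart Z : (\forall q \near p, Z q \in verts pi q) ->
    \forall x \near cM p p, 'D_(components p Z (param (chart_at p) x))
      (piN p \o param (chart_at p)) x = 0.
  move=> /(vertical_in_chart Uo Up sF) /(near_param Ap pp).
  by apply: filterS2 (near_paramK Ap pp) => x ->.
pose V := (U `&` UX `&` UY) `&` interior ([set x |
   'D_(components p X (param (chart_at p) x)) (piN p \o param (chart_at p)) x = 0]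
   `&` [set x |
   'D_(components p Y (param (chart_at p) x)) (piN p \o param (chart_at p)) x = 0]).
have Vo : open V.
  by apply: openI; [apply: openI => //; exact: openI|exact: open_interior].
have Vp : V (cM p p).
  by split=> //; apply: filterI; [exact: (inchart X)|exact: (inchart Y)].
have dF x : V x -> differentiable (piN p \o param (chart_at p)) x.
  by move=> [[[Ux _] _] _]; exact: (sF 1%N).1.
rewrite memv_ker tangent_mapE; apply/eqP/rowP => k.
rewrite /tder derive_rV ?mxE; last by apply: diff_derivable; exact: dF.
rewrite /bracket -[T in tder (components p Y) p T](components_at p X).
rewrite -[T in tder (components p X) p T](components_at p Y).
have cK Z : components p Z p = (components p Z \o param (chart_at p)) (cM p p).
  by rewrite /= coordK.
rewrite (cK X) (cK Y) /tder.
apply: (kernel_involutive Vo Vp).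
- move=> l; apply: (@Ck_on_rV _ _ _ _ _ _ Vo).1.
  by apply: Ck_on_sub (sF l) => x [[[]]].
- by move=> l; apply: Ck_on_sub (sX' l) => x [[[]]].
- by move=> l; apply: Ck_on_sub (sY' l) => x [[[]]].
- move=> x Vx; rewrite -derive_rV; last by apply: diff_derivable; exact: dF.
  by have [_ /interior_subset[/= + _]] := Vx => ->; rewrite mxE.
- move=> x Vx; rewrite -derive_rV; last by apply: diff_derivable; exact: dF.
  by have [_ /interior_subset[/= _ +]] := Vx => ->; rewrite mxE.
Qed.

End VerticalDistribution.

(** * Orthonormal vertical frames *)

Section VerticalFrames.
Context {R : realType} {d n : nat} (M : manifold R d) (N : manifold R n).
Variables (g : M -> 'rV[R]_d -> 'rV[R]_d -> R) (pi : M -> N) (r : nat).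
Hypothesis gP : riemannian_metric g.
Hypothesis pi_smooth : smooth_map pi.
Hypothesis dim_verts : forall p, \dim (verts pi p) = r.
Implicit Types (p q : M) (X Y : M -> 'rV[R]_d) (v w : 'rV[R]_d).

(** Gram-Schmidt one vector at a time: as long as the frame is too short, some
    vertical vector at p lies outside its span; its vertical extension, made
    orthogonal to the frame, does not vanish near p and can be normalised. *)
Lemma vertical_frame_exists p : limg (tangent_map pi p) = fullv ->
  exists U : 'I_r -> M -> 'rV[R]_d, orthonormal_vertical_frame g pi p U.
Proof.
move=> surj.
suff H k : (k <= r)%N -> exists U : nat -> M -> 'rV[R]_d,
    (forall i, (i < k)%N -> smooth_field p (U i)) /\
    \forall q \near p, (forall i, (i < k)%N -> U i q \in verts pi q) /\
      (forall i j, (i < k)%N -> (j < k)%N -> g q (U i q) (U j q) = (i == j)%:R).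
  have [U [sU oU]] := H r (leqnn r).
  exists (fun i => U i); split=> [i|]; first exact: sU.
  by apply: filterS oU => q [vU oU]; split=> *; [exact: vU|exact: oU].
elim: k => [_|k IH kr]; first by exists (fun _ _ => 0); split=> //; apply: filterE.
have [U [sU nU]] := IH (ltnW kr).
have [vU oU] := nbhs_singleton nU.
have [w wV wU] : exists2 w, w \in verts pi p &
    w \notin <<[tuple U i p | i < k]>>%VS.
  apply/subvPn; apply/negP => /dimvS; rewrite dim_verts leqNgt => /negP; apply.
  by apply: leq_ltn_trans (dim_span _) _; rewrite size_tuple.
have [W [sW Wp nW]] := vertical_extension pi_smooth surj wV.
pose P q := \sum_(i < k) g q (W q) (U i q) *: U i q.
pose W' q := W q - P q.
have sP : smooth_field p P.
  apply: smooth_field_sum => i; have sUi := sU i (ltn_ord i).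
  exact: smooth_fieldZ (smooth_metric gP sW sUi) sUi.
have sW' : smooth_field p W' := smooth_fieldB sW sP.
have nW' : \forall q \near p, W' q \in verts pi q /\
    forall j, (j < k)%N -> g q (W' q) (U j q) = 0.
  apply: filterS2 nU nW => q [vUq oUq] vWq; split=> [|j jk].
    apply: (memvB vWq); apply: memv_suml => i _; apply: memvZ.
    exact: vUq (ltn_ord i).
  rewrite /W' metricBl// /P metric_suml// (bigD1 (Ordinal jk))//= metricZl//.
  rewrite oUq// eqxx mulr1 big1 ?addr0 ?subrr// => i ij; rewrite metricZl//.
  by rewrite oUq// (negPf (ij : (i : nat) != j)) mulr0.
have W'p : 0 < g p (W' p) (W' p).
  have [_ _ + _] := gP; apply; apply: contra wU.
  rewrite subr_eq0 Wp => /eqP ->; apply: memv_suml => i _; apply/memvZ/memv_span.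
  by apply/mapP; exists i => //; rewrite mem_enum.
have sN := smooth_metric gP sW' sW'.
have nN : \forall q \near p, 0 < g q (W' q) (W' q).
  exact: (cvgr_gt (g p (W' p) (W' p)) (smooth_near_continuous sN) _ W'p).
pose c q := (Num.sqrt (g q (W' q) (W' q)))^-1.
exists (fun i => if i == k then (fun q => c q *: W' q) else U i); split.
  move=> i; rewrite ltnS leq_eqVlt; case: eqP => [-> _|_ /= ik]; last exact: sU.
  exact: smooth_fieldZ (smooth_near_sqrtV sN W'p) sW'.
apply: filterS3 nU nW' nN => q [vUq oUq] [vWq oWq] Nq.
split=> [i|i j]; rewrite ltnS leq_eqVlt.
  by case: eqP => [-> _|_ /= ik]; [exact: memvZ|exact: vUq].
have oW'q j' : (j' < k)%N -> g q (c q *: W' q) (U j' q) = 0.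
  by move=> jk; rewrite metricZl// oWq// mulr0.
rewrite [in (j < k.+1)%N]ltnS [(j <= k)%N]leq_eqVlt.
case: (i =P k) => [->|ik] /= => [_|ik']; case: (j =P k) => [->|jk] /= jk'.
- rewrite eqxx metricZl// metricZr// mulrA -invfM -expr2 sqr_sqrtr ?ltW//.
  by rewrite mulVf// gt_eqF.
- by rewrite oW'q// eq_sym; case: eqP jk.
- by rewrite metricC// oW'q//; case: eqP ik.
- exact: oUq.
Qed.

Section Frame.
Variables (p : M) (U : 'I_r -> M -> 'rV[R]_d).
Hypothesis frU : orthonormal_vertical_frame g pi p U.

Lemma frame_expansion : \forall q \near p, forall v, v \in verts pi q ->
  v = \sum_i g q v (U i q) *: U i q.
Proof.
apply: filterS frU.2 => q [vU oU] v vV.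
exact: (orthonormal_expansion gP vU oU (dim_verts q) vV).
Qed.

(** Subtracting from v its expansion in the frame leaves a vector orthogonal to
    all vertical ones, so both projections can be read off the frame. *)
Lemma frame_splitting : \forall q \near p, forall v,
  [/\ daddv_pi (verts pi q) (horis g pi q) v = \sum_i g q v (U i q) *: U i q,
      daddv_pi (horis g pi q) (verts pi q) v =
        v - daddv_pi (verts pi q) (horis g pi q) v &
      daddv_pi (horis g pi q) (verts pi q) v \in horis g pi q].
Proof.
apply: filterS2 frU.2 frame_expansion => q [vU oU] expU v.
pose Pv := \sum_i g q v (U i q) *: U i q.
have PV : Pv \in verts pi q by apply: memv_suml => i _; exact: memvZ.
have HV : v - Pv \in horis g pi q.
  apply/mem_orthov => // w /expU ->; rewrite metric_suml// big1// => i _.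
  rewrite metricZl// metricBr// /Pv metric_sumr// (bigD1 i)//= metricZr// oU eqxx.
  rewrite mulr1 big1 ?addr0 => [|j ji]; first by rewrite [g q v _]metricC// subrr mulr0.
  by rewrite metricZr// oU eq_sym (negPf ji) mulr0.
have cap := orthov_cap gP q (verts pi q).
have cap' : (horis g pi q :&: verts pi q)%VS = 0%VS by rewrite capvC.
have add0 := daddv_pi_add cap (w := v - Pv) (subvP (addvSr _ _) _ HV).
have pi0 : daddv_pi (verts pi q) (horis g pi q) (v - Pv) = 0.
  by move: add0; rewrite (daddv_pi_id cap' HV) => /(canRL (addrK _)); rewrite subrr.
have E1 : daddv_pi (verts pi q) (horis g pi q) v = Pv.
  by rewrite -[in LHS](subrK Pv v) linearD/= pi0 add0r (daddv_pi_id cap PV).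
have E2 : daddv_pi (horis g pi q) (verts pi q) v = v - Pv.
  have vE : v \in (verts pi q + horis g pi q)%VS.
    by rewrite (_ : v = Pv + (v - Pv)) ?memv_add// addrC subrK.
  have := daddv_pi_add cap vE; rewrite E1 => E.
  by rewrite -[in RHS]E [Pv + _]addrC addrK.
by split; rewrite ?E2 ?E1.
Qed.

Lemma vproj_frame X : \forall q \near p,
  vproj g pi X q = \sum_i g q (X q) (U i q) *: U i q.
Proof. by apply: filterS frame_splitting => q /(_ (X q))[]. Qed.

Lemma hprojE X : \forall q \near p, hproj g pi X q = X q - vproj g pi X q.
Proof. by apply: filterS frame_splitting => q /(_ (X q))[]. Qed.

Lemma smooth_vproj X : smooth_field p X -> smooth_field p (vproj g pi X).
Proof.
move=> sX; have sU := frU.1.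
apply: smooth_field_eq (_ : smooth_field p
    (fun q => \sum_i g q (X q) (U i q) *: U i q)).
  by apply: filterS (vproj_frame X) => q ->.
apply: smooth_field_sum => i.
exact: smooth_fieldZ (smooth_metric gP sX (sU i)) (sU i).
Qed.

Lemma smooth_hproj X : smooth_field p X -> smooth_field p (hproj g pi X).
Proof.
move=> sX; apply: smooth_field_eq (smooth_fieldB sX (smooth_vproj sX)).
by apply: filterS (hprojE X) => q ->.
Qed.

End Frame.
End VerticalFrames.

(** * Germ dependence of a Levi-Civita connection *)

Section Connection.
Context {R : realType} {d : nat} (M : manifold R d).
Variable g : M -> 'rV[R]_d -> 'rV[R]_d -> R.
Variable nabla : (M -> 'rV[R]_d) -> (M -> 'rV[R]_d) -> M -> 'rV[R]_d.
Hypothesis nablaP : levi_civita g nabla.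
Implicit Types (p q : M) (X Y Z : M -> 'rV[R]_d) (f : M -> R).

Lemma nabla_smooth p X Y : smooth_field p X -> smooth_field p Y ->
  smooth_field p (nabla X Y).
Proof.
by move=> sX sY; have [] := nablaP sX sX sY sY (smooth_near_cst p (0 : R)).
Qed.

Lemma nabla_linearl p f X X' Y : smooth_near p f -> smooth_field p X ->
  smooth_field p X' -> smooth_field p Y ->
  nabla (fun q => f q *: X q + X' q) Y p = f p *: nabla X Y p + nabla X' Y p.
Proof. by move=> sf sX sX' sY; have [] := nablaP sX sX' sY sY sf. Qed.

Lemma nabla_leibniz p f X Y Y' : smooth_near p f -> smooth_field p X ->
  smooth_field p Y -> smooth_field p Y' ->
  nabla X (fun q => f q *: Y q + Y' q) p =
    tder f p (X p) *: Y p + f p *: nabla X Y p + nabla X Y' p.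
Proof. by move=> sf sX sY sY'; have [] := nablaP sX sX sY sY' sf. Qed.

Lemma nabla_torsion p X Y : smooth_field p X -> smooth_field p Y ->
  nabla X Y p - nabla Y X p = bracket X Y p.
Proof.
by move=> sX sY; have [] := nablaP sX sX sY sY (smooth_near_cst p (0 : R)).
Qed.

Lemma nabla_metric p X Y Z : smooth_field p X -> smooth_field p Y ->
  smooth_field p Z ->
  tder (fun q => g q (Y q) (Z q)) p (X p) =
    g p (nabla X Y p) (Z p) + g p (Y p) (nabla X Z p).
Proof.
by move=> sX sY sZ; have [] := nablaP sX sX sY sZ (smooth_near_cst p (0 : R)).
Qed.

(** The indicator of the set where two fields differ is smooth near a point
    near which they agree, and multiplying the difference by it changes
    nothing; so the Leibniz rules see only germs. *)
Lemma near_eq_indicator p X Y : (\forall q \near p, X q = Y q) ->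
  exists f, [/\ smooth_near p f, f p = 0 &
    X = fun q => f q *: (X q - Y q) + Y q].
Proof.
move=> XY; pose f q : R := (X q != Y q)%:R.
have f0 : \forall q \near p, 0 = f q by apply: filterS XY => q XYq; rewrite /f XYq eqxx.
exists f; split.
- exact: smooth_near_eq f0 (smooth_near_cst p 0).
- by rewrite -(nbhs_singleton f0).
- apply/funext => q; rewrite /f; case: eqP => [->|_]; first by rewrite scale0r add0r.
  by rewrite scale1r subrK.
Qed.

Lemma nabla_eqr p X Y Y' : smooth_field p X -> smooth_field p Y ->
  smooth_field p Y' -> (\forall q \near p, Y q = Y' q) ->
  nabla X Y p = nabla X Y' p.
Proof.
move=> sX sY sY' YY'; have [f [sf fp ->]] := near_eq_indicator YY'.
rewrite (nabla_leibniz sf sX (smooth_fieldB sY sY') sY').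
by rewrite (nbhs_singleton YY') subrr scaler0 fp scale0r !add0r.
Qed.

Lemma nabla_eql p X X' Y : smooth_field p X -> smooth_field p X' ->
  smooth_field p Y -> (\forall q \near p, X q = X' q) ->
  nabla X Y p = nabla X' Y p.
Proof.
move=> sX sX' sY XX'; have [f [sf fp ->]] := near_eq_indicator XX'.
by rewrite (nabla_linearl sf (smooth_fieldB sX sX') sX' sY) fp scale0r add0r.
Qed.

Lemma nablaDr p X Y Y' : smooth_field p X -> smooth_field p Y ->
  smooth_field p Y' -> nabla X (fun q => Y q + Y' q) p = nabla X Y p + nabla X Y' p.
Proof.
move=> sX sY sY'.
have s1 : smooth_near p (fun _ : M => 1 : R) by exact: smooth_near_cst.
have := nabla_leibniz s1 sX sY sY'; rewrite tder_cst scale0r add0r scale1r => <-.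
by congr (nabla X _ p); apply/funext => q; rewrite scale1r.
Qed.

Lemma nabla0r p X : smooth_field p X -> nabla X (fun=> 0) p = 0.
Proof.
move=> sX; have s0 := smooth_field0 p.
have := nablaDr sX s0 s0; under [X in nabla _ X p = _]eq_fun do rewrite addr0.
by move/eqP; rewrite -subr_eq0 opprD addrA subrr sub0r oppr_eq0 => /eqP.
Qed.

Lemma nabla_suml p (I : Type) (s : seq I) (f : I -> M -> R)
    (X : I -> M -> 'rV[R]_d) Y :
  (forall i, smooth_near p (f i)) -> (forall i, smooth_field p (X i)) ->
  smooth_field p Y ->
  nabla (fun q => \sum_(i <- s) f i q *: X i q) Y p =
  \sum_(i <- s) f i p *: nabla (X i) Y p.
Proof.
move=> sf sX sY; elim: s => [|i s IH].
  rewrite big_nil; under [X in nabla X _ _]eq_fun do rewrite big_nil.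
  (* The field 0 is 1 *: 0 + 0, so additivity forces its image to be 0. *)
  have s0 := smooth_field0 p.
  have s1 : smooth_near p (fun _ : M => 1 : R) by exact: smooth_near_cst.
  have := nabla_linearl s1 s0 s0 sY; rewrite /= !scale1r addr0.
  by move/eqP; rewrite -subr_eq0 opprD addrA subrr sub0r oppr_eq0 => /eqP.
rewrite big_cons; under [X in nabla X _ _]eq_fun do rewrite big_cons.
have sS : smooth_field p (fun q => \sum_(j <- s) f j q *: X j q).
  by apply: smooth_field_sum => j; exact: smooth_fieldZ (sf j) (sX j).
by rewrite (nabla_linearl (sf i) (sX i) sS sY) IH.
Qed.

End Connection.

(** * The second fundamental form of the fibres *)

Section SecondFundamentalForm.
Context {R : realType} {d n : nat} (M : manifold R d) (N : manifold R n).
Variables (g : M -> 'rV[R]_d -> 'rV[R]_d -> R)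
  (nabla : (M -> 'rV[R]_d) -> (M -> 'rV[R]_d) -> M -> 'rV[R]_d)
  (pi : M -> N) (r : nat).
Hypothesis gP : riemannian_metric g.
Hypothesis nablaP : levi_civita g nabla.
Hypothesis pi_smooth : smooth_map pi.
Hypothesis dim_verts : forall p, \dim (verts pi p) = r.
Variables (p : M) (U : 'I_r -> M -> 'rV[R]_d).
Hypothesis frU : orthonormal_vertical_frame g pi p U.
Implicit Types (X Y Z A B C W : M -> 'rV[R]_d).

Local Notation V := (vproj g pi).
Local Notation H := (hproj g pi).
Local Notation vertical X := (\forall q \near p, X q \in verts pi q).

Let sU i : smooth_field p (U i). Proof. exact: frU.1. Qed.
Let nablaS X Y : smooth_field p X -> smooth_field p Y -> smooth_field p (nabla X Y).
Proof. exact: (nabla_smooth nablaP). Qed.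
Let sV X : smooth_field p X -> smooth_field p (V X).
Proof. exact: (smooth_vproj gP dim_verts frU). Qed.
Let sH X : smooth_field p X -> smooth_field p (H X).
Proof. exact: (smooth_hproj gP dim_verts frU). Qed.

Lemma frame_vertical i : vertical (U i).
Proof. by apply: filterS frU.2 => q []. Qed.

Lemma vproj_vertical X : vertical (V X).
Proof. by apply: filterE => q; exact: memv_pi. Qed.

Lemma hproj_horizontal X q w : w \in verts pi q -> g q w (H X q) = 0.
Proof. by move: w; apply/mem_orthov => //; exact: memv_pi. Qed.

Lemma vproj_id X : vertical X -> \forall q \near p, V X q = X q.
Proof.
apply: filterS2 (frame_expansion gP dim_verts frU) => q expU XV.
rewrite [RHS]expU//; move: expU.
by rewrite /vproj daddv_pi_id ?(orthov_cap gP)// => /(_ _ XV) <-.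
Qed.

Lemma hproj0 X : vertical X -> \forall q \near p, H X q = 0.
Proof.
move=> vX; apply: filterS2 (hprojE gP dim_verts frU X) (vproj_id vX) => q -> ->.
by rewrite subrr.
Qed.

Lemma metric_vproj X w : w \in verts pi p -> g p (V X p) w = g p (X p) w.
Proof.
move=> wV; have := nbhs_singleton (hprojE gP dim_verts frU X).
move=> /(congr1 (g p w)); rewrite hproj_horizontal// metricBr// => /esym/eqP.
by rewrite subr_eq0 => /eqP; rewrite ![g p w _]metricC.
Qed.

Lemma metric_hproj X w : w \in horis g pi p -> g p (H X p) w = g p (X p) w.
Proof.
move=> wH; rewrite (nbhs_singleton (hprojE gP dim_verts frU X)) metricBl//.
have -> : g p (V X p) w = 0; last by rewrite subr0.
by apply: (elimT (mem_orthov gP p (verts pi p) w) wH); exact: memv_pi.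
Qed.

(** Differentiating g(HX, W) = 0 along A. *)
Lemma shape_operator A X W : smooth_field p A -> smooth_field p X ->
  smooth_field p W -> vertical W ->
  g p (nabla A (H X) p) (W p) = - g p (H X p) (H (nabla A W) p).
Proof.
move=> sA sX sW vW.
have : tder (fun q => g q (H X q) (W q)) p (A p) = 0.
  rewrite (tder_near_eq (g := fun=> 0)) ?tder_cst//.
  by apply: filterS vW => q Wq; rewrite metricC// hproj_horizontal.
rewrite (nabla_metric nablaP sA (sH sX) sW).
move/eqP; rewrite addr_eq0 => /eqP ->; congr (- _).
by rewrite [RHS]metricC// [RHS]metric_hproj 1?metricC//; exact: memv_pi.
Qed.

(** Projecting the field under nabla costs, against a vertical field, a product
    of two horizontal parts: this is the source of the quadratic terms of the
    Gauss equation. *)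
Lemma metric_nabla_vproj A X W : smooth_field p A -> smooth_field p X ->
  smooth_field p W -> vertical W ->
  g p (V (nabla A (V X)) p) (W p) =
  g p (nabla A X p) (W p) + g p (H X p) (H (nabla A W) p).
Proof.
move=> sA sX sW vW; rewrite metric_vproj ?(nbhs_singleton vW)//.
have XE : \forall q \near p, X q = V X q + H X q.
  by apply: filterS (hprojE gP dim_verts frU X) => q ->; rewrite subrKC.
rewrite (nabla_eqr nablaP sA sX _ XE); last first.
  exact: smooth_fieldD (sV sX) (sH sX).
rewrite (nablaDr nablaP sA (sV sX) (sH sX)) metricDl//.
by rewrite (shape_operator sA sX sW vW) subrK.
Qed.

Lemma gauss_equation A B C W : smooth_field p A -> smooth_field p B ->
  smooth_field p C -> smooth_field p W -> vertical W ->
  Rhat g pi nabla A B C W p =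
  g p (curvature nabla A B C p) (W p)
  - g p (H (nabla B C) p) (H (nabla A W) p)
  + g p (H (nabla A C) p) (H (nabla B W) p).
Proof.
move=> sA sB sC sW vW; have Wp := nbhs_singleton vW.
rewrite /Rhat /curvature /nablahat !(metricDl gP, metricNl gP) metric_vproj//.
rewrite (metric_nabla_vproj sA (nablaS sB sC) sW vW).
rewrite (metric_nabla_vproj sB (nablaS sA sC) sW vW).
by rewrite opprD !addrA; congr (_ + _); rewrite -!addrA; congr (_ + (_ + _)); exact: addrC.
Qed.

(** The difference of the two sides is the horizontal part of the bracket of two
    vertical fields. *)
Lemma hproj_nabla_sym X Y : smooth_field p X -> smooth_field p Y ->
  vertical X -> vertical Y -> H (nabla X Y) p = H (nabla Y X) p.
Proof.
move=> sX sY vX vY; apply/eqP; rewrite -subr_eq0 /hproj -linearB/=.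
rewrite (nabla_torsion nablaP sX sY).
have bV := bracket_vertical pi_smooth sX sY vX vY.
have [_ -> _] := nbhs_singleton (frame_splitting gP dim_verts frU) (bracket X Y p).
by rewrite daddv_pi_id ?orthov_cap// subrr.
Qed.

(** Tensoriality in the first argument; that in the second follows from it by
    [hproj_nabla_sym]. *)
Lemma hproj_nabla_vproj X Y : smooth_field p X -> smooth_field p Y ->
  H (nabla (V X) Y) p = \sum_i g p (X p) (U i p) *: H (nabla (U i) Y) p.
Proof.
move=> sX sY; pose a i q := g q (X q) (U i q).
have sa i : smooth_near p (a i) := smooth_metric gP sX (sU i).
have sP : smooth_field p (fun q => \sum_i a i q *: U i q).
  by apply: smooth_field_sum => i; exact: smooth_fieldZ (sa i) (sU i).
rewrite /hproj (nabla_eql nablaP (sV sX) sP sY (vproj_frame gP dim_verts frU X)).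
rewrite (nabla_suml nablaP _ sa sU sY) linear_sum/=.
by apply: eq_bigr => i _; rewrite linearZ.
Qed.

Definition second_form i j : 'rV[R]_d := H (nabla (U i) (U j)) p.

Lemma oneillT_frame i j : oneillT g pi nabla (U i) (U j) p = second_form i j.
Proof.
have VU k := vproj_id (frame_vertical k).
have E1 : nabla (V (U i)) (V (U j)) p = nabla (U i) (U j) p.
  rewrite (nabla_eqr nablaP (sV (sU i)) (sV (sU j)) (sU j) (VU j)).
  exact: (nabla_eql nablaP (sV (sU i)) (sU i) (sU j) (VU i)).
have E2 : nabla (V (U i)) (H (U j)) p = 0.
  rewrite (nabla_eqr nablaP (sV (sU i)) (sH (sU j)) (smooth_field0 p)
    (hproj0 (frame_vertical j))).
  exact: (nabla0r nablaP (sV (sU i))).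
rewrite [LHS](_ : _ =
    daddv_pi (horis g pi p) (verts pi p) (nabla (V (U i)) (V (U j)) p) +
    daddv_pi (verts pi p) (horis g pi p) (nabla (V (U i)) (H (U j)) p)) //.
by rewrite E1 E2 linear0 addr0.
Qed.

(** The part of the O'Neill tensor on vertical arguments is a combination of the
    h_ij by tensoriality, and the other part is its adjoint by
    [shape_operator]. *)
Lemma oneillT_eq0 : (forall i j, second_form i j = 0) ->
  forall X Y, smooth_field p X -> smooth_field p Y -> oneillT g pi nabla X Y p = 0.
Proof.
move=> S0 X Y sX sY.
have S0' Z i : smooth_field p Z -> H (nabla (V Z) (U i)) p = 0.
  move=> sZ; rewrite (hproj_nabla_vproj sZ (sU i)) big1// => j _.
  by rewrite -/(second_form j i) S0 scaler0.
have H0 : H (nabla (V X) (V Y)) p = 0.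
  rewrite (hproj_nabla_vproj sX (sV sY)) big1// => i _.
  rewrite (hproj_nabla_sym (sU i) (sV sY) (frame_vertical i) (vproj_vertical Y)).
  by rewrite S0' ?scaler0.
have V0 : V (nabla (V X) (H Y)) p = 0.
  rewrite [LHS](nbhs_singleton (frame_expansion gP dim_verts frU)) ?memv_pi//.
  rewrite big1// => i _; have vUi := nbhs_singleton (frame_vertical i).
  rewrite (metric_vproj _ vUi).
  rewrite (shape_operator (sV sX) sY (sU i) (frame_vertical i)) (S0' _ _ sX).
  by rewrite metric0r// oppr0 scale0r.
by rewrite /oneillT H0 V0 addr0.
Qed.

(** The trace over i and j of the Gauss equation: the products g(h_ii, h_jj) add
    up to the square of the unnormalised mean curvature vector, and by symmetry
    the products g(h_ij, h_ji) are squared norms. *)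
Lemma tauhat_frame (k : R) :
  (forall i j, g p (curvature nabla (U j) (U i) (U i) p) (U j p) =
     k * (1 - (i == j)%:R)) ->
  tauhat g pi nabla U p =
    k * r%:R * (r%:R - 1)
    - r%:R ^+ 2 * g p (mean_curvature g pi nabla U p) (mean_curvature g pi nabla U p)
    + \sum_j \sum_i g p (second_form i j) (second_form i j).
Proof.
move=> curv.
have -> : tauhat g pi nabla U p =
    \sum_j \sum_i (k * (1 - (i == j)%:R)
      - g p (second_form i i) (second_form j j)
      + g p (second_form i j) (second_form i j)).
  apply: eq_bigr => j _; apply: eq_bigr => i _.
  rewrite [LHS](gauss_equation (sU j) (sU i) (sU i) (sU j) (frame_vertical j)).
  rewrite curv -/(second_form i i) -/(second_form j j) -/(second_form i j).
  by rewrite (hproj_nabla_sym (sU j) (sU i) (frame_vertical j) (frame_vertical i)).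
under eq_bigr do rewrite 2!big_split/=.
rewrite 2!big_split/=; congr (_ + _ + _).
  under eq_bigr do rewrite -mulr_sumr.
  rewrite -mulr_sumr -mulrA; congr (_ * _).
  transitivity (\sum_(j < r) (r%:R - 1 : R)); last first.
    by rewrite sumr_const card_ord -[LHS]mulr_natl.
  apply: eq_bigr => j _; rewrite sumrB sumr_const card_ord (bigD1 j)//= eqxx.
  by rewrite big1 ?addr0// => i /negPf ->.
pose S := \sum_j second_form j j.
transitivity (- g p S S).
  rewrite (metric_sumr gP) -[RHS]sumrN; apply: eq_bigr => j _.
  by rewrite (metric_suml gP) -[RHS]sumrN.
have -> : mean_curvature g pi nabla U p = r%:R^-1 *: S.
  by congr (_ *: _); apply: eq_bigr => j _; exact: oneillT_frame.
congr (- _); rewrite metricZl// metricZr// !mulrA expr2.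
(* r^-1 is 0 when r = 0, and then S is an empty sum. *)
have [r0|r0] := eqVneq r 0%N.
  have -> : S = 0 by rewrite /S big1// => j _; have := ltn_ord j; rewrite {2}r0.
  by rewrite metric0l// mulr0.
have rR : r%:R != 0 :> R by rewrite pnatr_eq0.
by rewrite mulfK// divff// mul1r.
Qed.

End SecondFundamentalForm.

(** * Anti-invariant submersions of quaternionic space forms *)

(** On vertical vectors the terms of the curvature tensor that involve J_alpha
    drop out, because J_alpha carries them to horizontal ones; the curvature is
    then that of a real space form of curvature c/4. *)
Lemma vertical_curvature (R : realType) (m n r : nat) (c : R)
    (M : manifold R (4 * m)) (N : manifold R n)
    (E : M -> {vspace 'End('rV[R]_(4 * m))})
    (g : M -> 'rV[R]_(4 * m) -> 'rV[R]_(4 * m) -> R)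
    (nabla : (M -> 'rV[R]_(4 * m)) -> (M -> 'rV[R]_(4 * m)) ->
             M -> 'rV[R]_(4 * m))
    (pi : M -> N) (p : M) (U : 'I_r -> M -> 'rV[R]_(4 * m)) :
  quaternionic_space_form E g nabla c -> anti_invariant E g pi ->
  orthonormal_vertical_frame g pi p U ->
  forall i j, g p (curvature nabla (U j) (U i) (U i) p) (U j p) =
    c / 4%:R * (1 - (i == j)%:R).
Proof.
move=> [[[gP exJ] _] curvE] anti [sU nU] i j.
have [vU oU] := nbhs_singleton nU; have [J JP] := exJ p.
rewrite (curvE p J JP (U j) (U i) (U i) (sU j) (sU i) (sU i)).
have gJ a k l : g p (J a p (U k p)) (U l p) = 0.
  rewrite metricC//; apply: (elimT (mem_orthov gP p (verts pi p) _)) (vU l).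
  exact: anti.
rewrite metricZl// metricDl// metricBl// !metricZl// metric_suml// big1.
  rewrite !oU !eqxx addr0 mulr1 [j == i]eq_sym; congr (_ * (1 - _)).
  by case: (i == j); rewrite ?mulr1 ?mulr0.
by move=> a _; rewrite !(metricDl gP, metricNl gP, metricZl gP) !gJ !mulr0 oppr0 !addr0.
Qed.

Theorem theorem3p2 (R : realType) (m n r : nat) (c : R)
    (M : manifold R (4 * m)) (N : manifold R n)
    (E : M -> {vspace 'End('rV[R]_(4 * m))})
    (gM : M -> 'rV[R]_(4 * m) -> 'rV[R]_(4 * m) -> R)
    (gN : N -> 'rV[R]_n -> 'rV[R]_n -> R)
    (nabla : (M -> 'rV[R]_(4 * m)) -> (M -> 'rV[R]_(4 * m)) ->
             M -> 'rV[R]_(4 * m))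
    (pi : M -> N)
    (nablaP : levi_civita gM nabla)
    (M_space_form : quaternionic_space_form E gM nabla c)
    (gN_metric : riemannian_metric gN)
    (pi_submersion : riemannian_submersion gM gN pi)
    (pi_anti_invariant : anti_invariant E gM pi)
    (dim_verts : forall p, \dim (verts pi p) = r) :
  (forall p (U : 'I_r -> M -> 'rV[R]_(4 * m)),
     orthonormal_vertical_frame gM pi p U ->
     let H := mean_curvature gM pi nabla U in
     c / 4%:R * r%:R * (r%:R - 1) - r%:R ^+ 2 * gM p (H p) (H p)
       <= tauhat gM pi nabla U p) /\
  ((forall p (U : 'I_r -> M -> 'rV[R]_(4 * m)),
      orthonormal_vertical_frame gM pi p U ->
      let H := mean_curvature gM pi nabla U in
      tauhat gM pi nabla U p
        = c / 4%:R * r%:R * (r%:R - 1) - r%:R ^+ 2 * gM p (H p) (H p)) <->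
   totally_geodesic_fibers gM pi nabla).
Proof.
have gP : riemannian_metric gM by have [[[]]] := M_space_form.
have [_ pi_smooth _ surj _] := pi_submersion.
have tauE p U (frU : orthonormal_vertical_frame gM pi p U) :=
  tauhat_frame gP nablaP pi_smooth dim_verts frU
    (vertical_curvature M_space_form pi_anti_invariant frU).
have S_ge0 p (U : 'I_r -> M -> 'rV[R]_(4 * m)) i j :
    0 <= gM p (second_form gM nabla pi p U i j) (second_form gM nabla pi p U i j).
  exact: metric_ge0.
split=> [p U frU|].
  by rewrite /= (tauE p U frU) lerDl; apply: sumr_ge0 => j _; exact: sumr_ge0.
split=> [eq_tau p X Y sX sY|geodesic p U frU H].
  have [U frU] := vertical_frame_exists gP pi_smooth dim_verts (surj p).
  apply: (oneillT_eq0 gP nablaP pi_smooth dim_verts frU) => // i j.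
  have /eqP := eq_tau p U frU.
  rewrite (tauE p U frU) -subr_eq0 addrAC subrr add0r.
  rewrite psumr_eq0 => [/allP/(_ j (mem_index_enum j))|k _]; last exact: sumr_ge0.
  rewrite /= psumr_eq0// => /allP/(_ i (mem_index_enum i))/eqP.
  exact: metric_eq0.
rewrite (tauE p U frU) [X in _ + X]big1 ?addr0// => j _; rewrite big1// => i _.
rewrite -(oneillT_frame gP nablaP dim_verts frU i j).
by rewrite geodesic ?metric0r//; have [] := frU.
Qed.
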